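(* Let $T>0$, let $I\subseteq\mathbb{R}$ be a non-empty open interval, let $\Omega:=(0,T)\times I$, and assume that $u\in C^0([0,T),H^s(\mathbb{R}))$, $s>3/2$, is a solution of $$u_t-u_{txx}+uu_x-uu_{xxx}=0.$$ If $u\big|_{\Omega}=0$, then $u\equiv 0$ on $[0,T)\times\mathbb{R}$ and, moreover, $u$ can be extended globally (as a solution defined for all $t\geq0$).
   Context: $H^s(\mathbb{R})$ is the usual Sobolev space. For $s>3/2$ the equation is understood in its equivalent non-local form $u_t+uu_x+\partial_x\Lambda^{-2}\left(\tfrac32u_x^2\right)=0$, where $\Lambda^{-2}f=g\ast f$ with $g(x)=e^{-|x|}/2$ (so $\Lambda^2=1-\partial_x^2$); solutions are those provided by local well-posedness, i.e. $u\in C^0([0,T);H^s(\mathbb{R}))\cap C^1([0,T);H^{s-1}(\mathbb{R}))$. *)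

(* Defs.v *)
From mathcomp Require Import all_boot all_order all_algebra.
From mathcomp Require Import all_classical all_reals all_analysis.
Import Order.TTheory GRing.Theory Num.Theory.
Import numFieldNormedType.Exports.

Set Implicit Arguments.
Unset Strict Implicit.
Unset Printing Implicit Defensive.

Local Open Scope classical_set_scope.
Local Open Scope ring_scope.

Section Sobolev.
Context {R : realType}.
Local Notation mu := (@lebesgue_measure R).
Local Notation L2norm f := (Lnorm mu 2%:E (EFin \o f)).
Implicit Types (s : R) (f a b g : R -> R) (J : set R) (u : R -> R -> R).

(* Real and imaginary parts of
   (2 pi)^(-1/2) * \int_(-n)^n exp(- i x xi) f(x) dx. *)
Definition fourier_trunc_re f (n : nat) (xi : R) : R :=
  (Num.sqrt (2 * pi))^-1 *
  \int[mu]_(x in `[- n%:R, n%:R]) (cos (x * xi) * f x).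

Definition fourier_trunc_im f (n : nat) (xi : R) : R :=
  - (Num.sqrt (2 * pi))^-1 *
  \int[mu]_(x in `[- n%:R, n%:R]) (sin (x * xi) * f x).

(* a + i b is the (Plancherel) Fourier transform of f in L^2. *)
Definition is_fourier f a b : Prop :=
  [/\ f \in Lfun mu 2%:E, a \in Lfun mu 2%:E, b \in Lfun mu 2%:E,
      L2norm (fourier_trunc_re f n \- a) @[n --> \oo] --> 0%E &
      L2norm (fourier_trunc_im f n \- b) @[n --> \oo] --> 0%E].

(* The L^2 norm of (1 + xi^2)^(s/2) |f^(xi)|. The Fourier transform of f is
   unique up to a null set, so that the infimum ranges over a single value;
   it is +oo when f has no Fourier transform in the above sense. *)
Definition sobolev_norm s f : \bar R :=
  ereal_inf [set N | exists a b, is_fourier f a b /\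
    N = L2norm (fun xi =>
          (1 + xi ^+ 2) `^ (s / 2) * Num.sqrt (a xi ^+ 2 + b xi ^+ 2))].

(* H^s(R), for s >= 0. *)
Definition sobolev s : set (R -> R) :=
  [set f | f \in Lfun mu 2%:E /\ (sobolev_norm s f < +oo)%E].

(* u belongs to C^0(J; H^s(R)). This is only used for s > 1/2, where each class
   in H^s(R) has a unique continuous representative: u t is that one. *)
Definition C0_sobolev s J u : Prop :=
  (forall t, J t -> continuous (u t) /\ sobolev s (u t)) /\
  (forall t0, J t0 ->
    sobolev_norm s (u t \- u t0) @[t --> within J (nbhs t0)] --> 0%E).

(* v is the time derivative of u on J, for the norm of H^s(R); it is one-sided
   at the endpoint 0 of [0, T[ and [0, +oo[. *)
Definition sobolev_time_derivative s J u v : Prop :=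
  forall t0, J t0 ->
    sobolev_norm s (fun x => (u t x - u t0 x) / (t - t0) - v t0 x)
      @[t --> within J t0^'] --> 0%E.

(* Lambda^(-2) f = g * f with g(x) = exp(-|x|) / 2. *)
Definition green (x : R) : R := expR (- `|x|) / 2.

Definition Lambda_m2 f (x : R) : R := \int[mu]_y (green (x - y) * f y).

(* u, in C^0(J; H^s) /\ C^1(J; H^(s-1)), solves
     u_t + u u_x + d_x Lambda^(-2) (3/2 u_x^2) = 0   on J x R,
   the non-local form of u_t - u_txx + u u_x - u u_xxx = 0. For s > 3/2 we have
   H^s(R) in C^1(R), so the space derivatives are classical ones. *)
Definition solution s J u : Prop :=
  C0_sobolev s J u /\
  exists ut : R -> R -> R,
    [/\ C0_sobolev (s - 1) J ut,
        sobolev_time_derivative (s - 1) J u ut &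
        forall t x, J t ->
          ut t x + u t x * derive1 (u t) x +
          derive1 (Lambda_m2 (fun y => 3 / 2 * (derive1 (u t) y) ^+ 2)) x = 0].

End Sobolev.

(* Main.v *)
(** On the open set [Omega] the solution vanishes, hence so do [u_x] and [u_t],
    and the equation leaves [d_x Lambda^(-2) h = 0] on [I] with
    [h = (3/2) u_x^2 >= 0].  As [h] vanishes on [I], there
    [Lambda^(-2) h x = A exp(-x) + B exp(x)], where [A] and [B] are the
    exponential moments of [h] to the left and to the right of [I].  A zero
    derivative at two points of [I] forces [A = B = 0], so [h = 0], [u_x = 0]
    and [u = 0].

    The analytic input is the Sobolev embedding: [H^s] controls the sup norm
    for [s > 1/2], and a continuous member of [H^s] is [C^1] with bounded
    derivative for [s > 3/2].  It follows from Fourier inversion for a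
    continuous square integrable function with integrable transform, which is
    obtained by inserting the factor [exp(-k |xi|)]: Fubini turns it into
    averaging against the Poisson kernel [k / (k^2 + y^2)], an approximate
    identity as [k] tends to [0]. *)

Require Import Defs.
From mathcomp Require Import all_boot all_order all_algebra.
From mathcomp Require Import all_classical all_reals all_analysis.
From mathcomp Require Import measurable_realfun ring lra.
Import Order.TTheory GRing.Theory Num.Theory.
Import numFieldNormedType.Exports.

Set Implicit Arguments.
Unset Strict Implicit.
Unset Printing Implicit Defensive.

Local Open Scope classical_set_scope.
Local Open Scope ring_scope.

(** * Dominated convergence and pairing in L^2 *)

Section integrals.
Context {R : realType}.
Local Notation mu := (@lebesgue_measure R).
Implicit Types (f g w : R -> R).

Lemma integrable_dominated f g : measurable_fun setT f ->
  mu.-integrable setT (EFin \o g) -> (forall x, `|f x| <= g x) ->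
  mu.-integrable setT (EFin \o f).
Proof.
move=> mf ig fg; apply: (le_integrable _ _ _ ig) => //.
  exact/measurable_EFinP.
by move=> x _ /=; rewrite lee_fin (le_trans (fg x))// ler_norm.
Qed.

(** Dominated convergence for real-valued integrals. The limit [f] is measurable as a pointwise
    limit, and integrable by domination, so [fine] passes to the limit. *)
Lemma Rintegral_dominated_cvg (F : nat -> R -> R) f g :
  (forall n, measurable_fun setT (F n)) -> mu.-integrable setT (EFin \o g) ->
  (forall n x, `|F n x| <= g x) -> (forall x, F n x @[n --> \oo] --> f x) ->
  \int[mu]_x F n x @[n --> \oo] --> \int[mu]_x f x.
Proof.
move=> mF ig Fg Ff.
have EFf x : (F n x)%:E @[n --> \oo] --> (f x)%:E.
  by apply: cvg_EFin; [exact: nearW|exact: Ff].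
have mEF n : measurable_fun setT (EFin \o F n) by apply/measurable_EFinP; exact: mF.
have mEf : measurable_fun setT (EFin \o f).
  by apply: (emeasurable_fun_cvg (fun n => EFin \o F n)) => // x _; exact: EFf.
have [||intf _ cE] := @dominated_convergence _ _ _ mu _ measurableT
  (fun n => EFin \o F n) (EFin \o f) (EFin \o g) mEF mEf _ ig.
- by apply: aeW => x _; exact: EFf.
- by apply: aeW => x n _ /=; rewrite lee_fin.
by apply: fine_cvg; rewrite /Rintegral fineK//; exact: integrable_fin_num intf.
Qed.

(* Cauchy-Schwarz: [| int (F n - a) w | <= |F n - a|_2 |w|_2]. *)
Lemma L2_pairing_cvg (F : nat -> R -> R) f w :
  (forall n, measurable_fun setT (F n)) ->
  (forall n, mu.-integrable setT (EFin \o (F n \* w))) ->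
  f \in Lfun mu 2%:E -> w \in Lfun mu 2%:E ->
  Lnorm mu 2%:E (EFin \o (F n \- f)) @[n --> \oo] --> 0%E ->
  \int[mu]_x (F n x * w x) @[n --> \oo] --> \int[mu]_x (f x * w x).
Proof.
move=> mF iF L2f L2w Ff.
have mf : measurable_fun setT f by move: (sub_Lfun_mfun L2f); rewrite inE.
have mw : measurable_fun setT w by move: (sub_Lfun_mfun L2w); rewrite inE.
have ifw : mu.-integrable setT (EFin \o (f \* w)).
  by apply/Lfun1_integrable; exact: Lfun2_mul_Lfun1.
have wfin : (Lnorm mu 2%:E (EFin \o w) \is a fin_num).
  by rewrite ge0_fin_numE ?Lnorm_ge0//; move: (sub_Lfun_finLfun L2w); rewrite inE.
have bnd n : (`|(\int[mu]_x (F n x * w x) - \int[mu]_x (f x * w x))%R|%R%:E <=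
    Lnorm mu 2%:E (EFin \o (F n \- f)%R) * Lnorm mu 2%:E (EFin \o w))%E.
  have iB : mu.-integrable setT (EFin \o (fun x => F n x * w x - f x * w x)).
    exact: (integrableB measurableT (iF n) ifw).
  rewrite -(RintegralB measurableT (iF n) ifw) EFin_normr_Rintegral//.
  apply: le_trans (le_abse_integral _ _ _) _ => //; first exact: measurable_int iB.
  apply: le_trans _ (hoelder _ _ _ _ _ _) => //.
  - rewrite Lnorm1 le_eqVlt; apply/orP; left; apply/eqP.
    by apply: eq_integral => x _ /=; rewrite mulrBl.
  - by apply: measurable_funB; [exact: mF|exact: mf].
  - by rewrite -mulr2n -(mulr_natl (2^-1)) divff.
apply/cvgrPdist_le => e e0.
have : (Lnorm mu 2%:E (EFin \o (F n \- f)%R) * Lnorm mu 2%:E (EFin \o w))%E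
    @[n --> \oo] --> (0 * Lnorm mu 2%:E (EFin \o w))%E.
  by apply: cvgeZr.
rewrite mul0e => /fine_cvgP[fin /cvgrPdist_le/(_ _ e0)].
apply: filterS2 fin => n fin.
rewrite sub0r normrN /= => h; rewrite distrC -lee_fin; apply: le_trans (bnd n) _.
by rewrite -(fineK fin) lee_fin (le_trans _ h)// ler_norm.
Qed.

End integrals.

(** * Integrals with an oscillating factor *)

Section oscillatory_integrals.
Context {R : realType}.
Local Notation mu := (@lebesgue_measure R).
Implicit Types (c f g w : R -> R).

(** Sequential continuity reduces this to dominated convergence with majorant [|f|]. The factor [c]
    stands for [cos], [sin] or [- sin]. *)
Lemma continuous_oscillatory_integral c f : continuous c ->
  (forall x, `|c x| <= 1) -> mu.-integrable setT (EFin \o f) ->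
  continuous (fun xi => \int[mu]_x (c (x * xi) * f x)).
Proof.
move=> cc c1 intf xi0.
have mf : measurable_fun setT f by apply/measurable_EFinP; exact: measurable_int intf.
apply/(@cvg_nbhsP _ R^o) => v vxi0.
apply: (@Rintegral_dominated_cvg _ (fun n x => c (x * v n) * f x) _
  (fun x => `|f x|)).
- move=> n; apply: measurable_funM => //.
  apply: (measurableT_comp (continuous_measurable_fun cc)).
  exact: measurable_funM.
- exact: integrable_norm.
- by move=> n x; rewrite normrM ler_piMl.
- move=> x; apply: cvgMr_tmp; apply: continuous_cvg; first exact: cc.
  exact: cvgMl_tmp.
Qed.

Lemma integrable_oscillatory c f xi : continuous c ->
  (forall x, `|c x| <= 1) -> mu.-integrable setT (EFin \o f) ->
  mu.-integrable setT (EFin \o (fun x => c (x * xi) * f x)).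
Proof.
move=> cc c1 intf.
have mf : measurable_fun setT f by apply/measurable_EFinP; exact: measurable_int intf.
apply: (@integrable_dominated _ _ (fun x => `|f x|)).
- apply: measurable_funM => //.
  apply: (measurableT_comp (continuous_measurable_fun cc)).
  exact: measurable_funM.
- exact: integrable_norm.
- by move=> x; rewrite normrM ler_piMl.
Qed.

(** The kernel [c (x * xi) * f x * w xi] is dominated by the product [|f x| |w xi|], so Fubini
    applies. The first conjunct is kept because linearity of the outer integral is needed later. *)
Lemma oscillatory_fubini c f w : continuous c -> (forall x, `|c x| <= 1) ->
  mu.-integrable setT (EFin \o f) -> mu.-integrable setT (EFin \o w) ->
  mu.-integrable setT (EFin \o (fun xi => (\int[mu]_x (c (x * xi) * f x)) * w xi)) /\
  \int[mu]_xi ((\int[mu]_x (c (x * xi) * f x)) * w xi) =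
  \int[mu]_x (f x * \int[mu]_xi (c (x * xi) * w xi)).
Proof.
move=> cc c1 intf intw.
have mf : measurable_fun setT f by apply/measurable_EFinP; exact: measurable_int intf.
have mw : measurable_fun setT w by apply/measurable_EFinP; exact: measurable_int intw.
pose K (z : R * R) : \bar R := (c (z.2 * z.1) * f z.2 * w z.1)%:E.
have mK : measurable_fun setT K.
  apply/measurable_EFinP; apply: measurable_funM; last first.
    by apply: (measurableT_comp mw); exact: measurable_fst.
  apply: measurable_funM; last first.
    by apply: (measurableT_comp mf); exact: measurable_snd.
  apply: (measurableT_comp (continuous_measurable_fun cc)).
  by apply: measurable_funM; [exact: measurable_snd|exact: measurable_fst].
(* Tonelli: the iterated integral of [|K|] is at most the product of the integrals of [|f|] and
   [|w|]. *)
have iK : (mu \x mu)%E.-integrable setT K.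
  have [_ h] := @integrable12ltyP _ _ _ _ _ mu mu K mK; apply: h.
  apply: (@le_lt_trans _ _ (\int[mu]_xi ((\int[mu]_x `|f x|) * `|w xi|)%:E)%E).
    apply: ge0_le_integral => //.
    + by move=> x _; exact: integral_ge0.
    + have maK : measurable_fun setT (abse \o K) by exact: measurableT_comp.
      exact: (@measurable_fun_fubini_tonelli_F _ _ _ _ R mu _ maK (fun z => abse_ge0 (K z))).
    + apply/measurable_EFinP; apply: measurable_funM => //.
      exact: measurableT_comp.
    move=> xi _.
    have if1 := integrable_norm intf.
    rewrite -RintegralZr//.
    have ifw : mu.-integrable setT (EFin \o (fun x => `|f x| * `|w xi|)).
      exact: (integrableZr measurableT `|w xi| if1).
    rewrite /Rintegral fineK; last exact: integrable_fin_num ifw.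
    apply: ge0_le_integral => //.
    + by apply: measurableT_comp => //; exact: (measurable_fun_pair2 xi mK).
    + exact: measurable_int ifw.
    move=> x _ /=; rewrite lee_fin !normrM ler_wpM2r//.
    by rewrite ler_piMl.
  apply: integrable_lty => //.
  exact: (integrableZl measurableT _ (integrable_norm intw)).
have FE : (fun xi => \int[mu]_x K (xi, x))%E =
    EFin \o (fun xi => (\int[mu]_x (c (x * xi) * f x)) * w xi).
  apply/funext => xi /=.
  have icf := integrable_oscillatory xi cc c1 intf.
  rewrite -RintegralZr// /Rintegral fineK//.
  apply: integrable_fin_num => //.
  exact: (integrableZr measurableT _ icf).
have GE : (fun x => \int[mu]_xi K (xi, x))%E =
    EFin \o (fun x => f x * \int[mu]_xi (c (x * xi) * w xi)).
  apply/funext => x /=.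
  have icw : mu.-integrable setT (EFin \o (fun xi => c (x * xi) * w xi)).
    have := integrable_oscillatory x cc c1 intw.
    by apply: eq_integrable => // xi _ /=; rewrite (mulrC x).
  rewrite -RintegralZl// /Rintegral fineK; last first.
    apply: integrable_fin_num => //.
    exact: (integrableZl measurableT _ icw).
  by apply: eq_integral => xi _; rewrite /K /= mulrA (mulrC (f x)).
split; first by rewrite -FE; exact: (integrable_fubini_F iK).
rewrite /Rintegral; congr fine.
transitivity (\int[mu]_xi \int[mu]_x K (xi, x))%E; first by rewrite FE.
transitivity (\int[mu]_x \int[mu]_xi K (xi, x))%E; last by rewrite GE.
exact: etrans (integral12_prod_meas1 iK) (esym (integral21_prod_meas1 iK)).
Qed.
End oscillatory_integrals.

(** * Even integrands on the line *)

Section even_integrals.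
Context {R : realType}.
Local Notation mu := (@lebesgue_measure R).
Implicit Types (c f g w F : R -> R) (l x y : R).

(** Evenness doubles the integral over the half-line, which the fundamental theorem of calculus
    evaluates as [l - F 0]. *)
Lemma integral_comp_norm f F l : (forall x, 0 <= x -> 0 <= f x) ->
  (forall x, 0 <= x -> {for x, continuous f}) ->
  (forall x, 0 <= x -> is_derive x 1 F (f x)) ->
  F x @[x --> +oo] --> l ->
  (\int[mu]_x (f `|x|)%:E = (2 * (l - F 0))%:E)%E.
Proof.
move=> f0 cf dF Fl.
have F0 : F x @[x --> 0^'+] --> F 0.
  apply: cvg_at_right_filter; apply/differentiable_continuous/derivable1_diffP.
  by apply: (@ex_derive _ _ _ _ _ _ (f 0)); exact: dF.
rewrite ge0_symfun_integralT.
- rewrite -set_itvcy.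
  have -> : (\int[mu]_(x in `[0%R, +oo[) (f `|x|)%:E = \int[mu]_(x in `[0%R, +oo[) (f x)%:E)%E.
    by apply: eq_integral => x; rewrite inE /= in_itv /= andbT => x0; rewrite ger0_norm.
  rewrite (ge0_continuous_FTC2y f0 _ Fl _ F0)// ?EFinM ?EFinB//.
  + apply/continuous_within_itvcyP; split.
      by move=> x; rewrite in_itv /= andbT => /ltW; exact: cf.
    by apply: cvg_at_right_filter; exact: cf.
  + by move=> x /ltW x0; apply: (@ex_derive _ _ _ _ _ _ (f x)); exact: dF.
  + move=> x; rewrite in_itv /= andbT => /ltW x0; rewrite derive1E.
    by have ? := dF x x0; rewrite derive_val.
- by move=> x; apply: f0.
- move=> x; apply: continuous_comp; first exact: norm_continuous.
  exact: cf.
- by move=> x /=; rewrite normrN.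
Qed.

Lemma integrable_comp_norm f F l : (forall x, 0 <= x -> 0 <= f x) ->
  (forall x, 0 <= x -> {for x, continuous f}) ->
  (forall x, 0 <= x -> is_derive x 1 F (f x)) ->
  F x @[x --> +oo] --> l ->
  mu.-integrable setT (fun x => (f `|x|)%:E).
Proof.
move=> f0 cf dF Fl; apply/integrableP; split.
  apply/measurable_EFinP; apply: continuous_measurable_fun => x.
  by apply: continuous_comp; [exact: norm_continuous|exact: cf].
under eq_integral do rewrite gee0_abs ?lee_fin ?f0//.
by rewrite (integral_comp_norm f0 cf dF Fl) ltry.
Qed.

Lemma eq_is_derive f g (x df dg : R) : is_derive x 1 f df -> f =1 g -> df = dg ->
  is_derive x 1 g dg.
Proof. by move=> fdf /funext <- <-. Qed.

Lemma is_derive_scale (f : R -> R) (k x df : R) :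
  is_derive (k * x) 1 f df -> is_derive x 1 (fun y => f (k * y)) (k * df).
Proof.
move=> dfk.
have dk : is_derive x 1 (fun y : R => k * y) k.
  have := is_deriveZ k (is_derive_id x (1 : R)).
  by rewrite /GRing.scale /= mulr1.
by have := @is_derive1_comp _ f (fun y => k * y) x _ _ dfk dk; rewrite mulrC.
Qed.

Lemma continuous_scale f (k : R) : continuous f -> continuous (fun x => f (k * x)).
Proof.
by move=> cf x; apply: continuous_comp; [exact: mulrl_continuous|exact: cf].
Qed.

Lemma cvgy_expR_scale (k : R) : 0 < k -> expR (- k * x) @[x --> +oo] --> (0 : R).
Proof.
move=> k0.
under eq_fun do rewrite mulNr.
apply: (@cvg_comp _ _ _ (fun x : R => k * x) (fun x => expR (- x)) _ (pinfty_nbhs R)).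
  by apply: gt0_cvgMry => //; exact: cvg_id.
exact: cvgr_expR.
Qed.

(** * The Fourier transform of [exp(-k |x|)] *)

Section poisson.
Context (k z : R) (k0 : 0 < k).

Let D : R := k ^+ 2 + z ^+ 2.
Let D0 : 0 < D. Proof. by rewrite /D ltr_pwDl ?exprn_gt0 ?sqr_ge0. Qed.

(* Adding [1] to the cosine makes the integrand nonnegative, as the fundamental
   theorem of calculus on a half-line requires. *)
Let f x := (1 + cos (z * x)) * expR (- k * x).
(** The antiderivative of [f] that tends to 0 at infinity: the quotient by [D] accounts for the
    cosine, the term [k^-1] for the added constant 1. *)
Let F x := expR (- k * x) * ((z * sin (z * x) - k * cos (z * x)) / D - k^-1).

Let f0 x : 0 <= x -> 0 <= f x.
Proof. by move=> _; rewrite mulr_ge0 ?expR_ge0// -lerBlDl sub0r cos_geN1. Qed.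

Let dF x : is_derive x 1 F (f x).
Proof.
have dc := @is_derive_scale _ z x _ (is_derive_cos (z * x)).
have ds := @is_derive_scale _ z x _ (is_derive_sin (z * x)).
have de := @is_derive_scale _ (- k) x _ (is_derive_expR (- k * x)).
have dG : is_derive x 1 (fun x => (z * sin (z * x) - k * cos (z * x)) * D^-1 - k^-1)
    ((z * (z * cos (z * x)) - k * (z * - sin (z * x))) * D^-1).
  apply: (eq_is_derive (is_deriveB (is_deriveZ D^-1 (is_deriveB (is_deriveZ z ds)
    (is_deriveZ k dc))) (is_derive_cst k^-1 x (1 : R)))) => [y|].
    by rewrite !fctE /= /GRing.scale /= (mulrC D^-1).
  by rewrite /GRing.scale /= subr0 mulrC.
apply: (eq_is_derive (is_deriveM de dG)) => [y //|].
rewrite /GRing.scale /= /f.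
have : D != 0 by exact: lt0r_neq0.
have : k != 0 by exact: lt0r_neq0.
rewrite /D => ? ?.
by field; apply/andP; split.
Qed.

Let F_cvg : F x @[x --> +oo] --> 0.
Proof.
pose C := (`|z| + k) / D + k^-1.
apply: norm_cvg0.
apply: (@squeeze_cvgr _ _ _ _ (cst 0) (fun x => expR (- k * x) * C)).
- apply: nearW => x; rewrite normr_ge0 /F /= normrM ger0_norm ?expR_ge0//.
  rewrite ler_wpM2l ?expR_ge0// (le_trans (ler_normB _ _))//.
  rewrite /C normrM normfV (gtr0_norm D0) (@ger0_norm _ k^-1) ?invr_ge0 ?(ltW k0)//.
  rewrite lerD2r ler_wpM2r ?invr_ge0 ?(ltW D0)// (le_trans (ler_normB _ _))//.
  rewrite !normrM lerD ?ler_piMr ?sin_max//.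
  by rewrite (gtr0_norm k0) ler_piMr ?cos_max// ltW.
- exact: cvg_cst.
- rewrite -[X in _ --> X](mul0r C); apply: cvgMr_tmp.
  exact: cvgy_expR_scale.
Qed.

Let cf x : 0 <= x -> {for x, continuous f}.
Proof.
move=> _; apply: cvgM.
  by apply: cvgD; [exact: cvg_cst|apply: continuous_scale; exact: continuous_cos].
by apply: continuous_scale; exact: continuous_expR.
Qed.

Let fE x : f `|x| = (1 + cos (z * x)) * expR (- k * `|x|).
Proof.
rewrite /f; congr ((1 + _) * _).
by have [x0|x0] := leP 0 x; [rewrite ger0_norm|rewrite ltr0_norm// mulrN cosN].
Qed.

Lemma integrable_poisson :
  mu.-integrable setT (fun x => ((1 + cos (z * x)) * expR (- k * `|x|))%:E).
Proof.
have := integrable_comp_norm f0 cf (fun x _ => dF x) F_cvg.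
by apply: eq_integrable => // x _; rewrite fE.
Qed.

Lemma integral_poisson :
  \int[mu]_x ((1 + cos (z * x)) * expR (- k * `|x|)) = 2 * (k / D + k^-1).
Proof.
transitivity (fine (2 * (0 - F 0))%:E).
  rewrite -(integral_comp_norm f0 cf (fun x _ => dF x) F_cvg) /Rintegral.
  by congr fine; apply: eq_integral => x _; rewrite fE.
by rewrite /= /F !mulr0 sin0 cos0 expR0 !mulr0 !mulr1 mul1r; ring.
Qed.
End poisson.

(** The case [z = 0] of the preceding integral, whose integrand is then twice the exponential. *)
Lemma integrable_exp_norm k : 0 < k ->
  mu.-integrable setT (EFin \o (fun x => expR (- k * `|x|))).
Proof.
move=> k0; have := integrableZl measurableT 2^-1 (integrable_poisson 0 k0).
apply: eq_integrable => // x _ /=.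
rewrite mul0r cos0 -EFinM; congr EFin; by field.
Qed.

Lemma integral_exp_norm k : 0 < k -> \int[mu]_x expR (- k * `|x|) = 2 / k.
Proof.
move=> k0; have := integral_poisson 0 k0.
rewrite (_ : (fun x => (1 + cos (0 * x)) * expR (- k * `|x|)) =
  (fun x => 2 * expR (- k * `|x|))); last first.
  by apply/funext => x; rewrite mul0r cos0.
rewrite RintegralZl//; last exact: integrable_exp_norm.
by move/(mulfI (lt0r_neq0 (ltr0n _ 2))) => ->; field; exact: lt0r_neq0.
Qed.

(** Subtracting the integral of the exponential removes the 1 that was added to the cosine. *)
Lemma fourier_exp_norm k z : 0 < k ->
  \int[mu]_x (cos (z * x) * expR (- k * `|x|)) = 2 * k / (k ^+ 2 + z ^+ 2).
Proof.
move=> k0; have := integral_poisson z k0.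
have ie := integrable_exp_norm k0.
have ic : mu.-integrable setT (EFin \o (fun x => cos (z * x) * expR (- k * `|x|))).
  have := integrableB measurableT (integrable_poisson z k0) ie.
  by apply: eq_integrable => // x _ /=; rewrite -EFinB; congr EFin; by ring.
rewrite (_ : (fun x => (1 + cos (z * x)) * expR (- k * `|x|)) =
  (fun x => expR (- k * `|x|) + cos (z * x) * expR (- k * `|x|))); last first.
  by apply/funext => x; rewrite mulrDl mul1r.
rewrite RintegralD// integral_exp_norm// => H.
by apply: (addrI (2 / k)); rewrite H; ring.
Qed.

Lemma Lfun2_sqr f : measurable_fun setT f ->
  mu.-integrable setT (EFin \o (fun x => f x ^+ 2)) -> f \in Lfun mu 2%:E.
Proof.
move=> mf /(integrable_lty measurableT) iy; rewrite inE; apply/andP; split; rewrite inE//=.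
rewrite /finite_norm unlock; apply: poweR_lty.
apply: le_lt_trans iy; rewrite le_eqVlt; apply/orP; left; apply/eqP.
apply: eq_integral => x _ /=.
by rewrite powR_mulrn// real_normK// num_real.
Qed.

Lemma Lfun2_exp_norm k : 0 < k -> (fun x => expR (- k * `|x|)) \in Lfun mu 2%:E.
Proof.
move=> k0.
have ie2 : mu.-integrable setT (EFin \o (fun x => expR (- (k + k) * `|x|))).
  by apply: integrable_exp_norm; rewrite addr_gt0.
apply: Lfun2_sqr.
  by apply/measurable_EFinP; exact: measurable_int (integrable_exp_norm k0).
move: ie2; apply: eq_integrable => // x _ /=.
by rewrite expr2 -expRD -mulrDl opprD.
Qed.

End even_integrals.

(** * The Poisson kernel *)

Section poisson_kernel.
Context {R : realType}.
Local Notation mu := (@lebesgue_measure R).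
Implicit Types (c f g w F : R -> R) (l x y k : R).

(** The usual factor [1 / pi] is left out, so the total mass is [pi]. *)
Definition poisson_kernel k y : R := k / (k ^+ 2 + y ^+ 2).

Lemma poisson_kernel_den k y : 0 < k -> 0 < k ^+ 2 + y ^+ 2.
Proof. by move=> k0; rewrite ltr_pwDl ?exprn_gt0 ?sqr_ge0. Qed.

Lemma poisson_kernel_ge0 k y : 0 < k -> 0 <= poisson_kernel k y.
Proof. by move=> k0; rewrite divr_ge0 ?ltW// poisson_kernel_den. Qed.

Lemma continuous_poisson_kernel k : 0 < k -> continuous (poisson_kernel k).
Proof.
move=> k0 y; apply: cvgM; first exact: cvg_cst.
apply: cvgV; first exact/lt0r_neq0/poisson_kernel_den.
by apply: cvgD; [exact: cvg_cst|exact: exprn_continuous].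
Qed.

(** The substitution [z = (y - x) / k] leads to the integral of [1 / (1 + z^2)], with antiderivative
    [atan]. *)
Lemma integral_poisson_kernel k x : 0 < k ->
  (\int[mu]_y (poisson_kernel k (y - x))%:E = pi%:E)%E.
Proof.
move=> k0.
have dF y : is_derive y 1 (fun y => k^-1 * (y - x)) k^-1.
  apply: (@eq_is_derive _ (k^-1 \*: (id - cst x)) _ _ (k^-1 *: (1 - 0))) => //.
  by rewrite /GRing.scale /= subr0 mulr1.
have F'E : derive1 (fun y => k^-1 * (y - x)) = cst k^-1.
  by apply/funext => y; rewrite derive1E derive_val.
pose G (z : R) := (1 + z ^+ 2)^-1.
have cG : continuous G by exact: continuous_oneDsqrV.
have G0 z : 0 <= G z by rewrite invr_ge0 addr_ge0 ?sqr_ge0.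
transitivity (\int[mu]_z (G z)%:E)%E; last first.
  transitivity (\int[mu]_z (G `|z|)%:E)%E.
    by apply: eq_integral => z _; rewrite /G real_normK// num_real.
  have dG (z : R) : 0 <= z -> is_derive z 1 atan (G z) by move=> _; exact: is_derive1_atan.
  rewrite (integral_comp_norm (fun z _ => G0 z) (fun z _ => cG z) dG (@cvgy_atan R)).
  by rewrite atan0 subr0 mulrC divfK.
rewrite (increasing_ge0_integration_by_substitutionT
  (F := fun y => k^-1 * (y - x)) (G := G))//.
- apply: eq_integral => y _; congr EFin.
  rewrite !fctE /= F'E /G /poisson_kernel /=.
  have := poisson_kernel_den (y - x) k0; have := k0.
  move=> /lt0r_neq0 h /lt0r_neq0 h2; field.
  by rewrite h h2.
- by move=> a b ab; rewrite ltr_pM2l ?invr_gt0// ltrD2r.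
- by rewrite F'E; exact: cst_continuous.
- by rewrite F'E; exact: is_cvg_cst.
- by rewrite F'E; exact: is_cvg_cst.
- apply: gt0_cvgMrNy; rewrite ?invr_gt0//; exact: cvg_addrr_Ny.
- by apply: gt0_cvgMry; rewrite ?invr_gt0//; exact: cvg_addrr.
Qed.

Lemma measurable_poisson_kernel k x : 0 < k ->
  measurable_fun setT (fun y => poisson_kernel k (y - x)).
Proof.
move=> k0.
have mP := continuous_measurable_fun (continuous_poisson_kernel k0).
apply: (measurableT_comp mP); exact: measurable_funB.
Qed.

Lemma integrable_poisson_kernel k x : 0 < k ->
  mu.-integrable setT (EFin \o (fun y => poisson_kernel k (y - x))).
Proof.
move=> k0; apply/integrableP; split.
  by apply/measurable_EFinP; exact: measurable_poisson_kernel.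
under eq_integral do rewrite /= ger0_norm ?poisson_kernel_ge0//.
by rewrite integral_poisson_kernel// ltry.
Qed.

(** The kernel is bounded by [1 / k], so its square is at most [1 / k] times the integrable kernel
    itself. *)
Lemma Lfun2_poisson_kernel k x : 0 < k ->
  (fun y => poisson_kernel k (y - x)) \in Lfun mu 2%:E.
Proof.
move=> k0; apply: Lfun2_sqr; first exact: measurable_poisson_kernel.
apply: (@integrable_dominated _ _ (fun y => k^-1 * poisson_kernel k (y - x))).
- by apply: measurable_funX; exact: measurable_poisson_kernel.
- exact: (integrableZl measurableT _ (integrable_poisson_kernel x k0)).
- move=> y; have P0 := poisson_kernel_ge0 (y - x) k0.
  rewrite ger0_norm ?sqr_ge0// expr2 ler_wpM2r//.
  rewrite /poisson_kernel ler_pdivrMr ?poisson_kernel_den//.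
  rewrite mulrDr expr2 mulrA mulVf ?lt0r_neq0// mul1r lerDl.
  by rewrite mulr_ge0 ?sqr_ge0// invr_ge0 ltW.
Qed.

Lemma integrable_mul_poisson_kernel f k x : 0 < k -> f \in Lfun mu 2%:E ->
  mu.-integrable setT (EFin \o (fun y => f y * poisson_kernel k (y - x))).
Proof.
move=> k0 L2f; apply/Lfun1_integrable.
by have := Lfun2_mul_Lfun1 L2f (Lfun2_poisson_kernel x k0).
Qed.

(** For [|y| >= d] one has [1 <= y^2 / d^2], hence [1 + y^2 <= (1 + d^-2) y^2]. Away from the origin
    the kernel is thus of order [k], with an integrable profile independent of [k]. *)
Lemma poisson_kernel_le_far k d y : 0 < k -> 0 < d -> d <= `|y| ->
  poisson_kernel k y <= k * (1 + d ^- 2) * poisson_kernel 1 y.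
Proof.
move=> k0 d0 dy; rewrite /poisson_kernel -!mulrA ler_pM2l// mul1r expr1n.
have d2 : 0 < d ^+ 2 by rewrite exprn_gt0.
have dy2 : d ^+ 2 <= y ^+ 2.
  by rewrite -(real_normK (num_real y)) ler_sqr ?nnegrE// ltW.
have y2 : 0 < y ^+ 2 by exact: lt_le_trans dy2.
have y20 : 0 < 1 + y ^+ 2 by rewrite addr_gt0.
rewrite ler_pdivlMr// mulrC ler_pdivrMr ?poisson_kernel_den//.
have t0 : 0 <= d ^- 2 by rewrite invr_ge0 ltW.
have : 1 <= d ^- 2 * y ^+ 2 by rewrite mulrC ler_pdivlMr// mul1r.
have : 0 <= d ^- 2 * k ^+ 2 by rewrite mulr_ge0 ?sqr_ge0.
have := sqr_ge0 k; rewrite mulrDr !mulrDl; lra.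
Qed.

(** The kernels form an approximate identity of mass [pi]. No bound on [f] is assumed: far from [x],
    square integrability of [f] and of the kernel of parameter 1 takes its place. *)
Lemma cvg_poisson_kernel f x : f \in Lfun mu 2%:E -> {for x, continuous f} ->
  \int[mu]_y (f y * poisson_kernel n.+1%:R^-1 (y - x)) @[n --> \oo] --> f x * pi.
Proof.
move=> L2f cf; apply/cvgrPdist_le => e e0.
have eta0 : 0 < e / 2 / pi by rewrite !divr_gt0// pi_gt0.
have /cvgrPdist_le/(_ _ eta0) := cf.
rewrite near_nbhs => -[d /= d0 fd].
have iabs k : 0 < k ->
    mu.-integrable setT (EFin \o (fun y => `|f y| * poisson_kernel k (y - x))).
  move=> k0; have := integrable_norm (integrable_mul_poisson_kernel x k0 L2f).
  by apply: eq_integrable => // y _ /=; rewrite normrM (ger0_norm (poisson_kernel_ge0 _ _)).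
(* An integrable majorant for the far part that does not depend on [k], using
   [|f x - f y| <= |f x| + |f y|]. *)
pose h y := (`|f y| + `|f x|) * poisson_kernel 1 (y - x).
have ih : mu.-integrable setT (EFin \o h).
  have := integrableD measurableT (iabs 1 ltr01)
    (integrableZl measurableT `|f x| (integrable_poisson_kernel x ltr01)).
  by apply: eq_integrable => // y _ /=; rewrite -EFinM -EFinD -mulrDl.
pose C := 1 + d ^- 2.
(* Within [d] of [x], [f] oscillates by at most [e / (2 pi)]; beyond, the kernel
   is at most [k * C] times the kernel of parameter [1]. *)
have main k : 0 < k -> `|f x * pi - \int[mu]_y (f y * poisson_kernel k (y - x))| <=
    e / 2 + k * (C * \int[mu]_y h y).
  move=> k0.
  have iP := integrable_poisson_kernel x k0.
  have ifP := integrable_mul_poisson_kernel x k0 L2f.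
  have icP : mu.-integrable setT (EFin \o (fun y => f x * poisson_kernel k (y - x))).
    exact: (integrableZl measurableT _ iP).
  have IP : \int[mu]_y poisson_kernel k (y - x) = pi.
    by rewrite /Rintegral integral_poisson_kernel.
  (* Writing [pi] as the mass of the kernel turns the difference into one integral of [(f x - f y)]
     against the kernel. *)
  rewrite -[in f x * pi]IP -RintegralZl// -RintegralB//.
  have ikh : mu.-integrable setT (EFin \o (fun y => k * (C * h y))).
    exact: (integrableZl measurableT k (integrableZl measurableT C ih)).
  have ieP : mu.-integrable setT (EFin \o (fun y => e / 2 / pi * poisson_kernel k (y - x))).
    exact: (integrableZl measurableT _ iP).
  have idP := integrableB measurableT icP ifP.
  apply: (le_trans (le_normr_Rintegral measurableT idP)).
  have -> : e / 2 + k * (C * \int[mu]_y h y) =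
      \int[mu]_y (e / 2 / pi * poisson_kernel k (y - x) + k * (C * h y)).
    have iCh : mu.-integrable setT (EFin \o (fun y => C * h y)).
      exact: (integrableZl measurableT C ih).
    rewrite (RintegralD measurableT ieP ikh) (RintegralZl _ measurableT iP).
    rewrite (RintegralZl k measurableT iCh) (RintegralZl C measurableT ih).
    by rewrite IP divfK// lt0r_neq0// pi_gt0.
  apply: le_Rintegral => //.
  - exact: integrable_norm idP.
  - exact: (integrableD measurableT ieP ikh).
  move=> y _; rewrite -mulrBl normrM (ger0_norm (poisson_kernel_ge0 _ k0)).
  have h0 : 0 <= h y by rewrite mulr_ge0 ?addr_ge0 ?poisson_kernel_ge0.
  have C0 : 0 <= C by rewrite addr_ge0 ?invr_ge0 ?exprn_ge0 ?ltW.
  have [yd|yd] := ltP `|y - x| d.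
    rewrite -[leLHS]addr0 lerD//; last by rewrite mulr_ge0 ?(ltW k0)// mulr_ge0.
    rewrite ler_wpM2r ?poisson_kernel_ge0//.
    by apply: fd; rewrite /ball /= distrC.
  rewrite -[leLHS]add0r lerD//.
    by rewrite mulr_ge0 ?poisson_kernel_ge0// ltW.
  rewrite (_ : k * (C * h y) =
      (`|f x| + `|f y|) * (k * C * poisson_kernel 1 (y - x))); last first.
    by rewrite /h; ring.
  rewrite ler_pM ?normr_ge0 ?poisson_kernel_ge0 ?ler_normB//.
  exact: poisson_kernel_le_far.
have : n.+1%:R^-1 * (C * \int[mu]_y h y) @[n --> \oo] --> 0 * (C * \int[mu]_y h y).
  by apply: cvgMr_tmp; exact: cvg_harmonic.
rewrite mul0r => /cvgrPdist_le/(_ _ (divr_gt0 e0 (ltr0n _ 2))).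
apply: filterS => n; rewrite sub0r normrN => hn.
have k0 : 0 < n.+1%:R^-1 :> R by rewrite invr_gt0.
apply: le_trans (main _ k0) _.
by rewrite [leRHS]splitr lerD2l (le_trans (ler_norm _) hn).
Qed.

End poisson_kernel.

(** * Fourier inversion *)

Section inversion.
Context {R : realType}.
Local Notation mu := (@lebesgue_measure R).
Implicit Types (c f g w F a b : R -> R) (l x y k : R).

Lemma Lfun2_measurable f : f \in Lfun mu 2%:E -> measurable_fun setT f.
Proof. by move=> /sub_Lfun_mfun; rewrite inE. Qed.

Lemma measurable_oscillation c x : continuous c -> measurable_fun setT (fun y => c (x * y)).
Proof. by move=> cc; apply: continuous_measurable_fun; exact: continuous_scale. Qed.

(** * Truncation to the intervals [[-n, n]] *)

Section truncation.
Context (f : R -> R) (cf : continuous f).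

Let fn (n : nat) : R -> R := f \_ `[- n%:R, n%:R].

Lemma integrable_truncation (n : nat) : mu.-integrable setT (EFin \o fn n).
Proof.
have ci : mu.-integrable `[- n%:R, n%:R] (EFin \o f).
  apply: continuous_compact_integrable; first exact: segment_compact.
  exact: continuous_subspaceT.
have := proj1 (@integrable_mkcond _ _ _ mu _ (EFin \o f) (measurable_itv _)) ci.
apply: eq_integrable => // x _ /=.
by rewrite /fn !patchE; case: ifPn.
Qed.

Lemma truncation_oscillatory c n xi :
  \int[mu]_(x in `[- n%:R, n%:R]) (c (x * xi) * f x) =
  \int[mu]_x (c (x * xi) * fn n x).
Proof.
rewrite Rintegral_mkcond; apply: eq_Rintegral => x _.
by rewrite /fn !patchE; case: ifPn => // _; rewrite mulr0.
Qed.

(** Dominated convergence with majorant [|f g|]; at each [x] the sequence is constant once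
    [n >= |x|]. *)
Lemma truncation_cvg g : mu.-integrable setT (EFin \o (fun x => f x * g x)) ->
  measurable_fun setT g ->
  \int[mu]_x (fn n x * g x) @[n --> \oo] --> \int[mu]_x (f x * g x).
Proof.
move=> ifg mg; apply: (Rintegral_dominated_cvg (g := fun x => `|f x * g x|)).
- move=> n; apply: measurable_funM => //.
  by apply/measurable_EFinP; exact: measurable_int (integrable_truncation n).
- exact: integrable_norm ifg.
- by move=> n x; rewrite /fn patchE; case: ifPn => // _; rewrite mul0r normr0.
move=> x; apply: cvg_near_cst; near=> n.
rewrite /fn patchE mem_set//= in_itv /= -ler_norml.
by near: n; exact: nbhs_infty_ger.
Unshelve. all: by end_near. Qed.

End truncation.

Lemma Lfun2_oscillatory_exp c x k : continuous c -> (forall y, `|c y| <= 1) -> 0 < k ->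
  (fun xi => c (x * xi) * expR (- k * `|xi|)) \in Lfun mu 2%:E.
Proof.
move=> cc c1 k0; have L2e := Lfun2_exp_norm k0.
have me := Lfun2_measurable L2e.
have mce : measurable_fun setT (fun xi => c (x * xi) * expR (- k * `|xi|)).
  by apply: measurable_funM => //; exact: measurable_oscillation.
apply: Lfun2_sqr => //.
apply: (integrable_dominated _ (Lfun2_integrable_sqr L2e)).
  exact: measurable_funX.
move=> y; rewrite ger0_norm ?sqr_ge0// exprMn ler_piMl ?sqr_ge0//.
by rewrite -(real_normK (num_real _)) expr_le1.
Qed.

(** The inner integral is continuous in [x] and bounded by the integral of [|w|]. *)
Lemma integrable_mul_oscillatory c f w : continuous c -> (forall x, `|c x| <= 1) ->
  mu.-integrable setT (EFin \o f) -> mu.-integrable setT (EFin \o w) ->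
  mu.-integrable setT (EFin \o (fun x => f x * \int[mu]_xi (c (x * xi) * w xi))).
Proof.
move=> cc c1 intf intw.
have mf : measurable_fun setT f by apply/measurable_EFinP; exact: measurable_int intf.
have CE x : \int[mu]_xi (c (x * xi) * w xi) = \int[mu]_xi (c (xi * x) * w xi).
  by apply: eq_Rintegral => xi _; rewrite mulrC [in RHS]mulrC (mulrC x).
pose W := \int[mu]_xi `|w xi|.
apply: (@integrable_dominated _ _ (fun x => W * `|f x|)).
- apply: measurable_funM => //; under eq_fun do rewrite CE.
  by apply: continuous_measurable_fun; exact: continuous_oscillatory_integral.
- exact: (integrableZl measurableT W (integrable_norm intf)).
move=> x; rewrite normrM mulrC ler_wpM2r// CE.
have icw := integrable_oscillatory x cc c1 intw.
apply: (le_trans (le_normr_Rintegral measurableT icw)).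
apply: le_Rintegral => //; [exact: integrable_norm icw|exact: integrable_norm intw|].
by move=> xi _; rewrite normrM ler_piMl.
Qed.

(** The left side is the real part of the integral of [(a + i b) exp(i x xi) exp(-k |xi|)]. The
    weights are in [L^2], so it is the limit of the same pairings with the truncated transforms; for
    these Fubini moves the weights onto the kernel. *)
Lemma fourier_inversion_exp f a b x k : is_fourier f a b -> continuous f -> 0 < k ->
  \int[mu]_xi (a xi * (cos (x * xi) * expR (- k * `|xi|))) -
  \int[mu]_xi (b xi * (sin (x * xi) * expR (- k * `|xi|))) =
  2 * (Num.sqrt (2 * pi))^-1 * \int[mu]_y (f y * poisson_kernel k (y - x)).
Proof.
move=> [L2f L2a L2b fa fb] cf k0.
set w1 := fun xi => cos (x * xi) * expR (- k * `|xi|).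
set w2 := fun xi => sin (x * xi) * expR (- k * `|xi|).
have cosM := @cos_max R; have sinM := @sin_max R.
have ccos := @continuous_cos R; have csin := @continuous_sin R.
have L2w1 : w1 \in Lfun mu 2%:E by exact: Lfun2_oscillatory_exp.
have L2w2 : w2 \in Lfun mu 2%:E by exact: Lfun2_oscillatory_exp.
have ie := integrable_exp_norm k0.
have iosc c : continuous c -> (forall y, `|c y| <= 1) ->
    mu.-integrable setT (EFin \o (fun xi => c (x * xi) * expR (- k * `|xi|))).
  move=> cc c1; have := integrable_oscillatory x cc c1 ie.
  by apply: eq_integrable => // y _ /=; rewrite (mulrC y).
have iw1 : mu.-integrable setT (EFin \o w1) by exact: iosc.
have iw2 : mu.-integrable setT (EFin \o w2) by exact: iosc.
set s := (Num.sqrt (2 * pi))^-1.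
pose fn (n : nat) : R -> R := f \_ `[- n%:R, n%:R].
have ifn n : mu.-integrable setT (EFin \o fn n) by exact: integrable_truncation.
have reE n : fourier_trunc_re f n = fun xi => s * \int[mu]_y (cos (y * xi) * fn n y).
  by apply/funext => xi; rewrite /fourier_trunc_re truncation_oscillatory.
have imE n : fourier_trunc_im f n = fun xi => - s * \int[mu]_y (sin (y * xi) * fn n y).
  by apply/funext => xi; rewrite /fourier_trunc_im truncation_oscillatory.
have [Fc1 Fc2] := all_and2 (fun n => oscillatory_fubini ccos cosM (ifn n) iw1).
have [Fs1 Fs2] := all_and2 (fun n => oscillatory_fubini csin sinM (ifn n) iw2).
have mre n : measurable_fun setT (fourier_trunc_re f n).
  rewrite reE; apply: measurable_funM => //; apply: continuous_measurable_fun.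
  exact: continuous_oscillatory_integral.
have mim n : measurable_fun setT (fourier_trunc_im f n).
  rewrite imE; apply: measurable_funM => //; apply: continuous_measurable_fun.
  exact: continuous_oscillatory_integral.
have ire n : mu.-integrable setT (EFin \o (fourier_trunc_re f n \* w1)).
  rewrite reE; have := integrableZl measurableT s (Fc1 n).
  by apply: eq_integrable => // y _; exact: (congr1 EFin (mulrA _ _ _)).
have iim n : mu.-integrable setT (EFin \o (fourier_trunc_im f n \* w2)).
  rewrite imE; have := integrableZl measurableT (- s) (Fs1 n).
  by apply: eq_integrable => // y _; exact: (congr1 EFin (mulrA _ _ _)).
have ca := L2_pairing_cvg mre ire L2a L2w1 fa.
have cb := L2_pairing_cvg mim iim L2b L2w2 fb.
(* The two products combine into [cos ((y - x) xi)], which leaves the Fourier transform of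
   [exp(-k |xi|)] at [y - x]. *)
have kerE y : \int[mu]_xi (cos (y * xi) * w1 xi) + \int[mu]_xi (sin (y * xi) * w2 xi) =
    2 * poisson_kernel k (y - x).
  have ic : mu.-integrable setT (EFin \o (fun xi => cos (y * xi) * w1 xi)).
    have := integrable_oscillatory y ccos cosM iw1.
    by apply: eq_integrable => // z _ /=; rewrite (mulrC y).
  have is' : mu.-integrable setT (EFin \o (fun xi => sin (y * xi) * w2 xi)).
    have := integrable_oscillatory y csin sinM iw2.
    by apply: eq_integrable => // z _ /=; rewrite (mulrC y).
  rewrite -(RintegralD measurableT ic is') /poisson_kernel mulrA.
  rewrite -fourier_exp_norm//; apply: eq_Rintegral => xi _.
  by rewrite mulrBl cosB /w1 /w2; ring.
have L n : \int[mu]_xi (fourier_trunc_re f n xi * w1 xi) -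
    \int[mu]_xi (fourier_trunc_im f n xi * w2 xi) =
    2 * s * \int[mu]_y (fn n y * poisson_kernel k (y - x)).
  (* The minus sign in the imaginary part of the transform turns the difference into a sum. *)
  transitivity (s * \int[mu]_y (fn n y * \int[mu]_xi (cos (y * xi) * w1 xi)) +
      s * \int[mu]_y (fn n y * \int[mu]_xi (sin (y * xi) * w2 xi))).
    rewrite -Fc2 -Fs2 -(RintegralZl s measurableT (Fc1 n)).
    rewrite -(RintegralZl s measurableT (Fs1 n)) -[X in _ = _ + X]opprK.
    congr (_ + _).
      by apply: eq_Rintegral => xi _; rewrite reE -mulrA.
    congr (- _); rewrite -mulN1r -(RintegralZl (-1) measurableT).
      by apply: eq_Rintegral => xi _; rewrite imE mulN1r !mulNr -mulrA.
    exact: (integrableZl measurableT s (Fs1 n)).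
  have iC := integrable_mul_oscillatory ccos cosM (ifn n) iw1.
  have iS := integrable_mul_oscillatory csin sinM (ifn n) iw2.
  rewrite -mulrDr -(RintegralD measurableT iC iS) (mulrC 2) -mulrA; congr (_ * _).
  rewrite -RintegralZl//; last first.
    apply: (integrable_dominated _ (integrable_norm (integrable_mul_poisson_kernel x k0 L2f))).
      apply: measurable_funM; last exact: measurable_poisson_kernel.
      by apply/measurable_EFinP; exact: measurable_int (ifn n).
    by move=> y /=; rewrite /fn patchE; case: ifPn => // _; rewrite mul0r normr0.
  apply: eq_Rintegral => y _.
  by rewrite -mulrDr kerE; ring.
have c2 : 2 * s * \int[mu]_y (fn n y * poisson_kernel k (y - x)) @[n --> \oo] -->
    2 * s * \int[mu]_y (f y * poisson_kernel k (y - x)).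
  apply: cvgMl_tmp; apply: truncation_cvg => //.
  - exact: integrable_mul_poisson_kernel.
  - exact: measurable_poisson_kernel.
have c1 := cvgB ca cb.
apply: (cvg_unique _ _ c2) => //.
by rewrite -(funext L); exact: c1.
Qed.

(** Let the damping parameter tend to 0 along [1 / (n + 1)]: the left side converges by domination
    by [|a|] and [|b|], the right side because the Poisson kernel is an approximate identity. *)
Lemma fourier_inversion f a b x : is_fourier f a b -> continuous f ->
  mu.-integrable setT (EFin \o a) -> mu.-integrable setT (EFin \o b) ->
  \int[mu]_xi (cos (x * xi) * a xi) - \int[mu]_xi (sin (x * xi) * b xi) =
  Num.sqrt (2 * pi) * f x.
Proof.
move=> ff cf ia ib; have [L2f L2a L2b _ _] := ff.
pose k (n : nat) : R := n.+1%:R^-1.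
have k0 n : 0 < k n by rewrite invr_gt0.
have kcvg : k n @[n --> \oo] --> 0 by exact: cvg_harmonic.
have lim c g : continuous c -> (forall y, `|c y| <= 1) ->
    mu.-integrable setT (EFin \o g) ->
    \int[mu]_xi (g xi * (c (x * xi) * expR (- k n * `|xi|))) @[n --> \oo] -->
    \int[mu]_xi (c (x * xi) * g xi).
  move=> cc c1 ig.
  have mg : measurable_fun setT g by apply/measurable_EFinP; exact: measurable_int ig.
  apply: (Rintegral_dominated_cvg (g := fun xi => `|g xi|)).
  - move=> n; apply: measurable_funM => //; apply: measurable_funM.
      exact: measurable_oscillation.
    by apply/measurable_EFinP; exact: measurable_int (integrable_exp_norm (k0 n)).
  - exact: integrable_norm.
  - move=> n xi; rewrite normrM ler_piMr// normrM mulr_ile1//.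
    by rewrite ger0_norm ?expR_ge0// -expR0 ler_expR mulNr oppr_le0 mulr_ge0// ltW.
  move=> xi; rewrite (_ : c (x * xi) * g xi = g xi * (c (x * xi) * 1)); last first.
    by rewrite mulr1 mulrC.
  apply: cvgMl_tmp; apply: cvgMl_tmp.
  rewrite -expR0; apply: continuous_cvg; first exact: continuous_expR.
  rewrite -(mul0r `|xi|) -{1}oppr0; apply: cvgMr_tmp; exact: cvgN.
have c1 : \int[mu]_xi (a xi * (cos (x * xi) * expR (- k n * `|xi|))) -
    \int[mu]_xi (b xi * (sin (x * xi) * expR (- k n * `|xi|))) @[n --> \oo] -->
    \int[mu]_xi (cos (x * xi) * a xi) - \int[mu]_xi (sin (x * xi) * b xi).
  apply: cvgB; apply: lim => //; [exact: continuous_cos|exact: cos_max|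
    exact: continuous_sin|exact: sin_max].
have c2 : 2 * (Num.sqrt (2 * pi))^-1 *
    \int[mu]_y (f y * poisson_kernel (k n) (y - x)) @[n --> \oo] -->
    2 * (Num.sqrt (2 * pi))^-1 * (f x * pi).
  by apply: cvgMl_tmp; exact: (cvg_poisson_kernel L2f (cf x)).
have s0 : 0 < Num.sqrt (2 * pi) :> R by rewrite sqrtr_gt0 mulr_gt0// pi_gt0.
have -> : Num.sqrt (2 * pi) * f x = 2 * (Num.sqrt (2 * pi))^-1 * (f x * pi).
  rewrite mulrAC [RHS]mulrC; apply: (mulfI (lt0r_neq0 s0)).
  rewrite mulrA -expr2 sqr_sqrtr ?mulr_ge0 ?pi_ge0// mulrA mulfV ?lt0r_neq0//.
  by ring.
apply: (cvg_unique _ c1) => //.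
by rewrite (funext (fun n => fourier_inversion_exp x ff cf (k0 n))); exact: c2.
Qed.
End inversion.

(** * Weights (1 + xi^2)^s *)

Section japanese_bracket.
Context {R : realType}.
Local Notation mu := (@lebesgue_measure R).
Implicit Types (c f g w r F a b : R -> R) (l x y k s : R).

Lemma cvgy_powRN k : 0 < k -> (1 + x) `^ (- k) @[x --> +oo] --> (0 : R).
Proof.
move=> k0; apply/cvgrPdist_le => e e0; near=> x.
have ei0 : 0 < e^-1 by rewrite invr_gt0.
(* This threshold is chosen so that raising it to the power [k] gives [1 / e]. *)
have xM : e^-1 `^ k^-1 <= 1 + x.
  apply: (@le_trans _ _ x); last by rewrite lerDr.
  by near: x; apply: nbhs_pinfty_ge; exact: num_real.
rewrite sub0r normrN ger0_norm ?powR_ge0// powRN.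
have Mk : e^-1 = (e^-1 `^ k^-1) `^ k by rewrite -powRrM mulVf ?lt0r_neq0// powRr1// ltW.
have M0 : 0 < e^-1 `^ k^-1 by rewrite powR_gt0.
have x0 : 0 < 1 + x by exact: lt_le_trans xM.
rewrite -[e]invrK lef_pV2 ?posrE ?powR_gt0// [leLHS]Mk.
by rewrite ge0_ler_powR ?nnegrE// ltW.
Unshelve. all: by end_near. Qed.

(** The antiderivative [- (1 + x)^(1 - k) / (k - 1)] tends to 0 at infinity because [k > 1]. *)
Lemma integrable_powR_norm k : 1 < k ->
  mu.-integrable setT (EFin \o (fun x => (1 + `|x|) `^ (- k))).
Proof.
move=> k1.
have k10 : 0 < k - 1 by rewrite subr_gt0.
have x0 x : 0 <= x -> 0 < 1 + x by move=> ?; rewrite ltr_pwDl.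
have did x : is_derive x 1 (fun y : R => 1 + y) 1.
  apply: (eq_is_derive (is_deriveD (is_derive_cst (1 : R) x 1) (is_derive_id x 1))) => //.
  by rewrite add0r.
have dF x : 0 <= x -> is_derive x 1 (fun y => - (k - 1)^-1 * (1 + y) `^ (- (k - 1)))
    ((1 + x) `^ (- k)).
  move=> /x0 x1.
  have dp := @is_derive1_comp _ _ _ _ _ _ (is_derive1_powR (- (k - 1)) x1) (did x).
  apply: (eq_is_derive (is_deriveZ (- (k - 1)^-1) dp)) => // .
  rewrite /GRing.scale /= mulr1 mulrA mulrNN mulVf ?lt0r_neq0// mul1r.
  by congr (_ `^ _); ring.
have cf x : 0 <= x -> {for x, continuous (fun y => (1 + y) `^ (- k))}.
  move=> /x0 x1.
  have dp := @is_derive1_comp _ _ _ _ _ _ (is_derive1_powR (- k) x1) (did x).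
  apply: differentiable_continuous; apply/derivable1_diffP.
  exact: (@ex_derive _ _ _ _ _ _ _ dp).
have lim : - (k - 1)^-1 * (1 + x) `^ (- (k - 1)) @[x --> +oo] --> - (k - 1)^-1 * 0.
  by apply: cvgMl_tmp; exact: cvgy_powRN.
exact: (integrable_comp_norm (fun x _ => powR_ge0 (1 + x) (- k)) cf dF lim).
Qed.

Lemma continuous_japanese s : continuous (fun xi : R => (1 + xi ^+ 2) `^ s).
Proof.
move=> x.
have x0 : 0 < 1 + x ^+ 2 by rewrite ltr_pwDl ?sqr_ge0.
apply: (@continuous_comp _ _ _ (fun xi : R => 1 + xi ^+ 2) (fun y => y `^ s)).
  by apply: cvgD; [exact: cvg_cst|exact: exprn_continuous].
apply: differentiable_continuous; apply/derivable1_diffP.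
exact: (@ex_derive _ _ _ _ _ _ _ (is_derive1_powR s x0)).
Qed.

(** From [(1 + |x|)^2 <= 2 (1 + x^2)], the square of the weight is at most [2^s (1 + |x|)^(-2 s)],
    integrable since [2 s > 1]. *)
Lemma Lfun2_japanese s : 1 / 2 < s ->
  (fun xi : R => (1 + xi ^+ 2) `^ (- (s / 2))) \in Lfun mu 2%:E.
Proof.
move=> s2.
have mJ := continuous_measurable_fun (@continuous_japanese (- (s / 2))).
apply: Lfun2_sqr => //.
have s1 : 1 < 2 * s by lra.
have s0 : 0 < s by lra.
apply: (@integrable_dominated _ _ (fun x => 2 `^ s * (1 + `|x|) `^ (- (2 * s)))).
- exact: measurable_funX.
- exact: (integrableZl measurableT (2 `^ s) (integrable_powR_norm s1)).
move=> x.
have x0 : 0 < 1 + x ^+ 2 by rewrite ltr_pwDl ?sqr_ge0.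
have nx0 : 0 < 1 + `|x| by rewrite ltr_pwDl.
rewrite ger0_norm ?sqr_ge0// expr2 -powRD; last by rewrite lt0r_neq0// implybT.
rewrite (_ : - (s / 2) + - (s / 2) = - s); last by field.
rewrite !powRN powRrM powR_mulrn ?(ltW nx0)//.
rewrite ler_pdivlMr ?powR_gt0 ?exprn_gt0// mulrC ler_pdivrMr ?powR_gt0//.
rewrite -powRM ?(ltW x0)//.
rewrite ge0_ler_powR ?nnegrE ?sqr_ge0 ?mulr_ge0 ?(ltW x0) ?(ltW s0)//.
rewrite -[in leRHS](real_normK (num_real x)).
have := sqr_ge0 (1 - `|x|); rewrite !expr2; lra.
Qed.

(** Cauchy-Schwarz for [r] written as [(1 + xi^2)^(-s/2)] times the weighted function; [K] is the
    [L^2] norm of the first factor. The strict bound by a real [e] fits the infimum in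
    [sobolev_norm]. *)
Lemma japanese_L2_L1 s : 1 / 2 < s -> exists2 K : R, 0 <= K &
  forall r (e : R), measurable_fun setT r ->
    (Lnorm mu 2%:E (EFin \o (fun xi => (1 + xi ^+ 2) `^ (s / 2) * r xi)%R) < e%:E)%E ->
    mu.-integrable setT (EFin \o r) /\ \int[mu]_xi `|r xi| <= K * e.
Proof.
move=> s2.
set w := fun xi : R => (1 + xi ^+ 2) `^ (- (s / 2)).
have L2w : w \in Lfun mu 2%:E by exact: Lfun2_japanese.
have wfin : (Lnorm mu 2%:E (EFin \o w) \is a fin_num).
  by rewrite ge0_fin_numE ?Lnorm_ge0//; move: (sub_Lfun_finLfun L2w); rewrite inE.
exists (fine (Lnorm mu 2%:E (EFin \o w))); first by rewrite fine_ge0// Lnorm_ge0.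
move=> r e mr; set G := fun xi : R => _ * r xi => Ge.
have mG : measurable_fun setT G.
  apply: measurable_funM => //; apply: continuous_measurable_fun.
  exact: continuous_japanese.
have L2G : G \in Lfun mu 2%:E.
  rewrite inE; apply/andP; split; rewrite inE//=.
  by rewrite /finite_norm (lt_trans Ge)// ltry.
have rE : r = w \* G.
  apply/funext => xi; rewrite /w /G /= mulrA -powRD ?addNr ?powRr0 ?mul1r//.
  by rewrite lt0r_neq0 ?implybT// ltr_pwDl ?sqr_ge0.
have ir : mu.-integrable setT (EFin \o r).
  by apply/Lfun1_integrable; rewrite rE; exact: Lfun2_mul_Lfun1.
split=> //.
have half : (2^-1 + 2^-1 = 1 :> R)%R by field.
have mw := Lfun2_measurable L2w.
have := @hoelder _ _ _ mu _ _ 2 2 mw mG (ltr0n _ 2) (ltr0n _ 2) half.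
rewrite -rE Lnorm1 => h.
rewrite -lee_fin /Rintegral fineK; last first.
  exact: integrable_fin_num (integrable_norm ir).
apply: le_trans h _; rewrite EFinM fineK//.
by apply: lee_pmul; rewrite ?Lnorm_ge0// ltW.
Qed.

End japanese_bracket.

(** * Sobolev embeddings *)

Section embedding.
Context {R : realType}.
Local Notation mu := (@lebesgue_measure R).
Implicit Types (c f g w r F a b : R -> R) (l x y k s : R).

(** The modulus of the Fourier transform [a + i b]. *)
Let amp a b xi := Num.sqrt (a xi ^+ 2 + b xi ^+ 2).

Lemma measurable_amp a b : measurable_fun setT a -> measurable_fun setT b ->
  measurable_fun setT (amp a b).
Proof.
move=> ma mb; apply: (measurableT_comp (continuous_measurable_fun (@sqrt_continuous R))).
by apply: measurable_funD; exact: measurable_funX.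
Qed.

Lemma norm_le_ampl a b xi : `|a xi| <= amp a b xi.
Proof. by rewrite -sqrtr_sqr ler_wsqrtr// lerDl sqr_ge0. Qed.

Lemma norm_le_ampr a b xi : `|b xi| <= amp a b xi.
Proof. by rewrite -sqrtr_sqr ler_wsqrtr// lerDr sqr_ge0. Qed.

Lemma fourier_measurable f a b : is_fourier f a b ->
  measurable_fun setT a /\ measurable_fun setT b.
Proof. by case=> _ /Lfun2_measurable ? /Lfun2_measurable ? _ _. Qed.

Lemma bounded_oscillatory c g x : continuous c -> (forall y, `|c y| <= 1) ->
  mu.-integrable setT (EFin \o g) ->
  `|\int[mu]_xi (c (x * xi) * g xi)| <= \int[mu]_xi `|g xi|.
Proof.
move=> cc c1 ig.
have icg : mu.-integrable setT (EFin \o (fun xi => c (x * xi) * g xi)).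
  have := integrable_oscillatory x cc c1 ig.
  by apply: eq_integrable => // xi _ /=; rewrite (mulrC x).
apply: (le_trans (le_normr_Rintegral measurableT icg)).
apply: le_Rintegral => //; [exact: integrable_norm icg|exact: integrable_norm ig|].
by move=> xi _; rewrite normrM ler_piMl.
Qed.

(** Fourier inversion writes [sqrt (2 pi) * f x] as a cosine and a sine integral, each bounded by
    the [L^1] norm of the modulus of the transform. The constant depends on [s] only, so small norms
    force small values. *)
Lemma sobolev_sup_bound s : 1 / 2 < s -> exists2 K : R, 0 <= K &
  forall f e x, continuous f -> (sobolev_norm s f < e%:E)%E -> `|f x| <= K * e.
Proof.
move=> s2; have [K K0 HK] := japanese_L2_L1 s2.
have t0 : 0 < Num.sqrt (2 * pi) :> R by rewrite sqrtr_gt0 mulr_gt0// pi_gt0.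
exists ((Num.sqrt (2 * pi))^-1 * (2 * K)).
  by rewrite !mulr_ge0// invr_ge0 ltW.
move=> f e x cf /ereal_inf_lt [_ [a [b [fab ->]]]] Ne.
have [ma mb] := fourier_measurable fab.
have [ir Ir] := HK _ _ (measurable_amp ma mb) Ne.
have ia := integrable_dominated ma ir (norm_le_ampl a b).
have ib := integrable_dominated mb ir (norm_le_ampr a b).
have bnd c g : continuous c -> (forall y, `|c y| <= 1) ->
    mu.-integrable setT (EFin \o g) -> (forall xi, `|g xi| <= amp a b xi) ->
    `|\int[mu]_xi (c (x * xi) * g xi)| <= K * e.
  move=> cc c1 ig gr; apply: le_trans Ir.
  apply: (le_trans (bounded_oscillatory x cc c1 ig)).
  apply: le_Rintegral => //; [exact: integrable_norm ig|exact: integrable_norm ir|].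
  by move=> xi _; rewrite (le_trans _ (ler_norm _)).
rewrite -mulrA mulrC ler_pdivlMr// mulrC.
rewrite -[X in X * _](ger0_norm (ltW t0)) -normrM -(fourier_inversion x fab cf ia ib).
rewrite (le_trans (ler_normB _ _))// -mulrA mulr2n mulrDl mul1r lerD// bnd//.
- exact: continuous_cos.
- exact: cos_max.
- exact: norm_le_ampl.
- exact: continuous_sin.
- exact: sin_max.
- exact: norm_le_ampr.
Qed.

(** Differentiation under the integral sign: the derivative of the integrand is bounded by
    [|xi * g xi|], uniformly in the parameter. *)
Lemma is_derive_oscillatory c c' g x : (forall y, is_derive y 1 c (c' y)) ->
  (forall y, `|c y| <= 1) -> (forall y, `|c' y| <= 1) ->
  mu.-integrable setT (EFin \o g) ->
  mu.-integrable setT (EFin \o (fun xi => xi * g xi)) ->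
  is_derive x 1 (fun y => \int[mu]_xi (c (y * xi) * g xi))
    (\int[mu]_xi (c' (x * xi) * (xi * g xi))).
Proof.
move=> dc c1 c'1 ig ixg.
have cc : continuous c.
  move=> y; apply: differentiable_continuous; apply/derivable1_diffP.
  exact: (@ex_derive _ _ _ _ _ _ _ (dc y)).
have dk y xi : is_derive y 1 (fun z => c (z * xi) * g xi) (c' (y * xi) * (xi * g xi)).
  have h : is_derive (xi * y) 1 c (c' (xi * y)) by exact: dc.
  apply: (eq_is_derive (is_deriveZ (g xi) (is_derive_scale h))) => [z|].
    by rewrite /GRing.scale /= [LHS]mulrC (mulrC xi).
  by rewrite /GRing.scale /= (mulrC xi y); ring.
have d1E y xi : partial1of2 (fun z xi => c (z * xi) * g xi) y xi =
    c' (y * xi) * (xi * g xi).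
  by rewrite partial1of2E derive_val.
have intf y : mu.-integrable setT (EFin \o (fun xi => c (y * xi) * g xi)).
  have := integrable_oscillatory y cc c1 ig.
  by apply: eq_integrable => // xi _ /=; rewrite (mulrC y).
have Ix : `]x - 1, x + 1[%classic x by rewrite /= in_itv /= ltrBlDr ltrDl ltr01.
have dG y xi : `]x - 1, x + 1[%classic y -> setT xi ->
    `|partial1of2 (fun z xi => c (z * xi) * g xi) y xi| <= `|xi * g xi|.
  by move=> _ _; rewrite d1E normrM ler_piMl.
have der : forall y xi : R, `]x - 1, x + 1[%classic y -> setT xi ->
   derivable (fun z : R => c (z * xi) * g xi) y 1.
  by move=> y xi _ _; exact: (@ex_derive _ _ _ _ _ _ _ (dk y xi)).
split.
  exact: (@derivable_under_integral _ _ _ mu _ _ measurableT x (x - 1) (x + 1) Ix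
    (fun y _ => intf y) der (fun xi => `|xi * g xi|) (fun _ => normr_ge0 _)
    (integrable_norm ixg) dG).
rewrite -derive1E.
rewrite (@differentiation_under_integral _ _ _ mu _ _ measurableT x (x - 1) (x + 1) Ix
    (fun y _ => intf y) der (fun xi => `|xi * g xi|) (fun _ => normr_ge0 _)
    (integrable_norm ixg) dG).
by apply: eq_Rintegral => xi _; rewrite d1E.
Qed.

(** One power of [(1 + xi^2)^(1/2)] is split off the weight, and the remaining order [s - 1 > 1/2]
    still gives integrability. Hence the transform and its product with [xi] are integrable, and the
    inversion formula can be differentiated. *)
Lemma sobolev_C1 s f : 3 / 2 < s -> continuous f -> sobolev s f ->
  [/\ forall x, derivable f x 1, continuous (derive1 f) &
      exists M, forall x, `|derive1 f x| <= M].
Proof.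
move=> s2 cf [_ fy]; have s12 : 1 / 2 < s - 1 by lra.
have [K K0 HK] := japanese_L2_L1 s12.
have [_ [a [b [fab ->]]] Ny] := ereal_inf_lt fy.
have [e Ne] : exists e : R, (Lnorm mu 2%:E (EFin \o (fun xi =>
    (1 + xi ^+ 2) `^ (s / 2) * amp a b xi)%R) < e%:E)%E.
  set N := Lnorm _ _ _ in Ny *; exists (fine N + 1).
  have Nfin : N \is a fin_num by rewrite ge0_fin_numE// Lnorm_ge0.
  by rewrite -[ltLHS]fineK// lte_fin ltrDl.
have [ma mb] := fourier_measurable fab.
(* Since [J] dominates both 1 and [|xi|], integrability of [J * amp a b] settles [a], [b], [xi a]
   and [xi b] together. *)
pose J xi : R := (1 + xi ^+ 2) `^ (1 / 2).
have J1 xi : 1 <= J xi.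
  have h1 : 1 <= 1 + xi ^+ 2 by rewrite lerDl sqr_ge0.
  have h2 : 0 <= 1 / 2 :> R by lra.
  by have := ler_powR h1 h2; rewrite powRr0.
have Jx xi : `|xi| <= J xi.
  rewrite /J div1r powR12_sqrt ?addr_ge0 ?sqr_ge0// -sqrtr_sqr.
  by rewrite ler_wsqrtr// lerDr.
pose r xi := J xi * amp a b xi.
have mr : measurable_fun setT r.
  apply: measurable_funM; last exact: measurable_amp.
  by apply: continuous_measurable_fun; exact: continuous_japanese.
have [ir _] : mu.-integrable setT (EFin \o r) /\ \int[mu]_xi `|r xi| <= K * e.
  apply: HK => //; move: Ne; congr (Lnorm _ _ _ < _)%E.
  apply/funext => xi /=; congr EFin; rewrite /r /J mulrA -powRD.
    by congr (_ `^ _ * _); field.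
  by rewrite lt0r_neq0 ?implybT// ltr_pwDl ?sqr_ge0.
have amp0 xi : 0 <= amp a b xi by exact: sqrtr_ge0.
have below g : measurable_fun setT g -> (forall xi, `|g xi| <= amp a b xi) ->
    mu.-integrable setT (EFin \o g) /\ mu.-integrable setT (EFin \o (fun xi => xi * g xi)).
  move=> mg gle; split.
    apply: (integrable_dominated mg ir) => xi; apply: (le_trans (gle xi)).
    by rewrite /r ler_peMl.
  apply: (integrable_dominated _ ir) => [|xi]; first exact: measurable_funM.
  by rewrite normrM ler_pM.
have [ia ixa] := below a ma (norm_le_ampl a b).
have [ib ixb] := below b mb (norm_le_ampr a b).
have ccos := @continuous_cos R; have csin := @continuous_sin R.
have cosM := @cos_max R; have sinM := @sin_max R.
have cNsin : continuous (fun y : R => - sin y) by move=> y; apply: cvgN; exact: csin.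
have NsinM y : `|- sin y| <= 1 :> R by rewrite normrN.
set c0 := (Num.sqrt (2 * pi) : R)^-1.
have t0 : 0 < Num.sqrt (2 * pi) :> R by rewrite sqrtr_gt0 mulr_gt0// pi_gt0.
have c00 : 0 <= c0 by rewrite invr_ge0 ltW.
pose Gc x := \int[mu]_xi (- sin (x * xi) * (xi * a xi)).
pose Gs x := \int[mu]_xi (cos (x * xi) * (xi * b xi)).
have df x : is_derive x 1 f (c0 * (Gc x - Gs x)).
  have dc := is_derive_oscillatory x (@is_derive_cos R) cosM NsinM ia ixa.
  have ds := is_derive_oscillatory x (@is_derive_sin R) sinM cosM ib ixb.
  apply: (eq_is_derive (is_deriveZ c0 (is_deriveB dc ds))) => // y.
  rewrite !fctE /= (fourier_inversion y fab cf ia ib).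
  by rewrite -[LHS]/(c0 * (Num.sqrt (2 * pi) * f y)) mulrA mulVf ?mul1r// lt0r_neq0.
have f'E : derive1 f = fun x => c0 * (Gc x - Gs x).
  by apply/funext => x; rewrite derive1E derive_val.
have cosc c g : continuous c -> (forall y, `|c y| <= 1) ->
    mu.-integrable setT (EFin \o g) -> continuous (fun x => \int[mu]_xi (c (x * xi) * g xi)).
  move=> cc c1 ig.
  rewrite (_ : (fun x => _) = (fun x => \int[mu]_xi (c (xi * x) * g xi))).
    exact: continuous_oscillatory_integral.
  apply/funext => x.
  by apply: eq_Rintegral => xi _; rewrite (mulrC x).
have cGc : continuous Gc by exact: (cosc _ _ cNsin NsinM ixa).
have cGs : continuous Gs by exact: (cosc _ _ ccos cosM ixb).
split.
- by move=> x; exact: (@ex_derive _ _ _ _ _ _ _ (df x)).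
- by rewrite f'E => x; apply: cvgMl_tmp; apply: cvgB; [exact: cGc|exact: cGs].
- exists (c0 * (\int[mu]_xi `|xi * a xi| + \int[mu]_xi `|xi * b xi|)) => x.
  rewrite f'E normrM ger0_norm// ler_wpM2l// (le_trans (ler_normB _ _))//.
  apply: lerD; first exact: (bounded_oscillatory _ cNsin NsinM ixa).
  exact: (bounded_oscillatory _ ccos cosM ixb).
Qed.

End embedding.

(** * The Green function argument *)

Section green.
Context {R : realType}.
Local Notation mu := (@lebesgue_measure R).
Implicit Types (f g h p : R -> R) (x y c M : R) (I : set R).

(** Otherwise [g] would exceed [p x / 2 > 0] on an interval and have positive integral. The separate
    [p] serves for [g] that is a cut-off of a continuous function. *)
Lemma integral_eq0_near g p x : (forall y, 0 <= g y) ->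
  mu.-integrable setT (EFin \o g) -> \int[mu]_y g y = 0 ->
  {for x, continuous p} -> (\forall y \near x, g y = p y) -> p x <= 0.
Proof.
move=> g0 ig Ig cp gp; rewrite leNgt; apply/negP => px.
have : \forall y \near x, p x / 2 <= g y.
  near=> y; rewrite (_ : g y = p y); last by near: y.
  rewrite ltW//; near: y; apply: (cvgr_gt (p x)) => //.
  by rewrite ltr_pdivrMr// ltr_pMr// ltr1n.
move=> [d /= d0 dg].
(* Half the radius keeps this closed interval inside the ball, and its measure is exactly [d]. *)
set E := `[x - d / 2, x + d / 2]%classic.
have mE : measurable E by exact: measurable_itv.
have muE : mu E = d%:E.
  rewrite lebesgue_measure_itv /= lte_fin ifT; last first.
    by rewrite ltrBlDr -addrA ltrDl addr_gt0 ?divr_gt0.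
  by rewrite -EFinB; congr EFin; field.
have : (\int[mu]_(y in E) (p x / 2)%:E <= \int[mu]_y (g y)%:E)%E.
  apply: (@le_trans _ _ (\int[mu]_(y in E) (g y)%:E)%E).
    apply: ge0_le_integral => //.
    - by move=> y _; rewrite lee_fin divr_ge0// ltW.
    - by apply: measurable_funTS; exact: measurable_int ig.
    move=> y; rewrite /E /= in_itv /= => /andP[y1 y2]; rewrite lee_fin; apply: dg.
    rewrite /ball /=; rewrite ltr_norml; apply/andP; split; lra.
  apply: ge0_subset_integral => //; first exact: measurable_int ig.
  by move=> y _; rewrite lee_fin.
have -> : (\int[mu]_(y in E) (p x / 2)%:E = (p x / 2)%:E * d%:E)%E.
  by rewrite -muE; exact: integral_cst.
have gfin : (\int[mu]_y (g y)%:E)%E \is a fin_num by exact: integrable_fin_num ig.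
rewrite -[leRHS]fineK// -EFinM lee_fin [X in _ <= X]Ig leNgt.
by rewrite mulr_gt0 ?divr_gt0.
Unshelve. all: by end_near. Qed.

(** For [x] in [I] the Green integral may be split at a fixed point [c] of [I] instead of at [x], as
    [h] vanishes in between. So the two exponential moments are constants, and the bound [M] makes
    them finite. *)
Lemma Lambda_m2_constant I h M : I !=set0 -> open I -> is_interval I ->
  (forall y, 0 <= h y) -> (forall y, h y <= M) -> continuous h ->
  (forall y, I y -> h y = 0) ->
  (forall y, I y -> derive1 (Lambda_m2 h) y = 0) ->
  forall y, h y = 0.
Proof.
move=> [c Ic] oI iI h0 hM ch hI dI.
have mh : measurable_fun setT h by exact: continuous_measurable_fun.
have M0 : 0 <= M by exact: le_trans (h0 0) (hM 0).
pose p y := expR y / 2 * h y.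
pose q y := expR (- y) / 2 * h y.
pose l : R -> R := p \_ [set y | y < c].
pose r : R -> R := q \_ [set y | c <= y].
have cp : continuous p.
  by move=> y; apply: cvgM; [apply: cvgMr_tmp; exact: continuous_expR|exact: ch].
have cq : continuous q.
  move=> y; apply: cvgM; last exact: ch.
  apply: cvgMr_tmp; apply: continuous_comp; [exact: opp_continuous|exact: continuous_expR].
have p0 y : 0 <= p y by rewrite mulr_ge0 ?divr_ge0 ?expR_ge0.
have q0 y : 0 <= q y by rewrite mulr_ge0 ?divr_ge0 ?expR_ge0.
have l0 y : 0 <= l y by rewrite /l patchE; case: ifPn.
have r0 y : 0 <= r y by rewrite /r patchE; case: ifPn.
have lE y : y < c -> l y = p y by move=> yc; rewrite /l patchE mem_set.
have lE0 y : c <= y -> l y = 0.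
  by move=> yc; rewrite /l patchE memNset//= => /lt_geF; rewrite yc.
have rE y : c <= y -> r y = q y by move=> yc; rewrite /r patchE mem_set.
have rE0 y : y < c -> r y = 0.
  by move=> yc; rewrite /r patchE memNset//= => /le_gtF; rewrite yc.
(* A common majorant of [l] and [r]: [y <= 2 |c| - |y|] when [y < c], and [- y <= 2 |c| - |y|] when
   [c <= y]. *)
pose W y := expR (2 * `|c|) / 2 * M * expR (- 1 * `|y|).
have iW : mu.-integrable setT (EFin \o W).
  exact: (integrableZl measurableT _ (integrable_exp_norm ltr01)).
have W0 y : 0 <= W y by rewrite !mulr_ge0 ?expR_ge0 ?invr_ge0.
have expW y z : z <= 2 * `|c| - `|y| -> expR z / 2 * h y <= W y.
  move=> zc; rewrite (_ : W y = expR (2 * `|c|) * expR (- 1 * `|y|) / 2 * M); last first.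
    by rewrite /W; ring.
  rewrite ler_pM ?divr_ge0 ?expR_ge0//.
  by rewrite ler_wpM2r ?invr_ge0// -expRD ler_expR mulN1r.
have il : mu.-integrable setT (EFin \o l).
  apply: (integrable_dominated _ iW).
    apply/(@measurable_restrictT _ _ _ _ _ p).
      by rewrite -set_itvNyo; exact: measurable_itv.
    by apply: measurable_funTS; exact: continuous_measurable_fun.
  move=> y; rewrite ger0_norm//; have [yc|yc] := ltP y c; last by rewrite lE0.
  rewrite lE//; apply: expW; have := ler_norm c; have [y1|y1] := leP 0 y.
    by rewrite (ger0_norm y1); lra.
  by rewrite (ltr0_norm y1); have := normr_ge0 c; lra.
have ir : mu.-integrable setT (EFin \o r).
  apply: (integrable_dominated _ iW).
    apply/(@measurable_restrictT _ _ _ _ _ q).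
      by rewrite -set_itvcy; exact: measurable_itv.
    by apply: measurable_funTS; exact: continuous_measurable_fun.
  move=> y; rewrite ger0_norm//; have [yc|yc] := ltP y c; first by rewrite rE0.
  rewrite rE//; apply: expW; have := ler_norm (- c); rewrite normrN.
  have [y1|y1] := leP 0 y.
    by rewrite (ger0_norm y1); have := normr_ge0 c; lra.
  by rewrite (ltr0_norm y1); lra.
set A := \int[mu]_y l y; set B := \int[mu]_y r y.
have LE x : I x -> Lambda_m2 h x = expR (- x) * A + expR x * B.
  move=> Ix.
  rewrite -(RintegralZl _ measurableT il) -(RintegralZl _ measurableT ir).
  rewrite -(RintegralD measurableT (integrableZl measurableT (expR (- x)) il)
    (integrableZl measurableT (expR x) ir)).
  apply: eq_Rintegral => y _; rewrite /green.
  (* If [y] lies between [x] and [c], it is in the interval [I] and [h y = 0]; otherwise [|x - y|]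
     has the sign that the chosen half expects. *)
  have [yc|yc] := ltP y c.
    rewrite lE// rE0// mulr0 addr0 /p; have [xy|xy] := ltP x y.
      by rewrite (hI y) ?mulr0//; apply: (iI x c) => //; rewrite (ltW xy) (ltW yc).
    by rewrite ger0_norm ?subr_ge0// opprB addrC expRD !mulrA.
  rewrite lE0// rE// mulr0 add0r /q; have [xy|xy] := ltP y x.
    by rewrite (hI y) ?mulr0//; apply: (iI c x) => //; rewrite (ltW xy) yc.
  by rewrite ler0_norm ?subr_le0// opprK expRD !mulrA.
have AB x : I x -> expR x * B = expR (- x) * A.
  move=> Ix; have d0 := dI x Ix.
  have de : is_derive x 1 (fun y => expR (- y) * A + expR y * B)
      (- expR (- x) * A + expR x * B).
    have dn := @is_derive1_comp _ expR -%R x _ _ (is_derive_expR (- x))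
      (is_deriveNid x (1 : R)).
    apply: (eq_is_derive (is_deriveD (is_deriveZ A dn) (is_deriveZ B (is_derive_expR x)))).
      move=> y; rewrite -[LHS]/(A * expR (- y) + B * expR y); ring.
    rewrite -[LHS]/(A * (expR (- x) * - 1) + B * expR x); ring.
  have : derive1 (fun y => expR (- y) * A + expR y * B) x = 0.
    rewrite -d0 !derive1E; apply: near_eq_derive => //.
    have : nbhs x I by exact: open_nbhs_nbhs.
    by apply: filterS => y Iy; rewrite LE.
  rewrite derive1E derive_val mulNr addrC => /eqP; rewrite subr_eq0 => /eqP ->//.
have [d Id d0] : exists2 d, I d & c < d.
  have : nbhs c I by exact: open_nbhs_nbhs.
  case=> e /= e0 eI; exists (c + e / 2); last by rewrite ltrDl divr_gt0.
  apply: eI; rewrite /ball /= opprD addNKr normrN gtr0_norm ?divr_gt0//.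
  by rewrite ltr_pdivrMr// ltr_pMr// ltr1n.
have B2 x : I x -> A = expR (x + x) * B.
  move=> Ix; rewrite expRD -mulrA AB// mulrA -expRD subrr expR0 mul1r//.
(* The relation [A = exp(2 x) B] at the distinct points [c] and [d] of [I] is possible only for
   [B = 0]. *)
have B0 : B = 0.
  have /eqP := B2 c Ic; rewrite (B2 d Id) -subr_eq0 -mulrBl mulf_eq0.
  case/orP => [|/eqP//]; rewrite subr_eq0 => /eqP/expR_inj; lra.
have A0 : A = 0 by rewrite (B2 c Ic) B0 mulr0.
move=> y; apply/eqP; rewrite eq_le h0 andbT.
have [yc|yc|->] := ltgtP y c; last by rewrite hI.
- have : p y <= 0.
    apply: (integral_eq0_near l0 il A0 (cp y)).
    by near=> z; apply: lE; near: z; exact: lt_nbhsl.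
  by rewrite /p pmulr_rle0// divr_gt0 ?expR_gt0.
- have : q y <= 0.
    apply: (integral_eq0_near r0 ir B0 (cq y)).
    by near=> z; apply: rE; apply: ltW; near: z; exact: lt_nbhsr.
  by rewrite /q pmulr_rle0// divr_gt0 ?expR_gt0.
Unshelve. all: by end_near. Qed.

End green.

(** * Vanishing of the solution *)

Section vanishing.
Context {R : realType}.
Local Notation mu := (@lebesgue_measure R).
Implicit Types (f g h : R -> R) (x y s : R) (J : set R) (u ut : R -> R -> R).

Lemma cvge0_lt {T : Type} (F : set_system T) {FF : Filter F} (f : T -> \bar R) (e : R) :
  f x @[x --> F] --> 0%E -> 0 < e -> \forall x \near F, (f x < e%:E)%E.
Proof.
move=> /fine_cvgP[fin /cvgrPdist_lt + e0] => /(_ _ e0).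
apply: filterS2 fin => x fin; rewrite sub0r normrN => h.
by rewrite -(fineK fin) lte_fin (le_lt_trans (ler_norm _) h).
Qed.

Lemma norm_le_scaled_eq0 (K v : R) : 0 <= K ->
  (forall e, 0 < e -> `|v| <= K * e) -> v = 0.
Proof.
move=> K0 small; apply/eqP; rewrite -normr_le0; apply/ler_addgt0Pr => e e0.
(* Dividing by [K + 1] covers the case [K = 0]. *)
rewrite add0r (le_trans (small (e / (K + 1)) _))//.
  by rewrite divr_gt0// ltr_wpDl.
by rewrite mulrCA ler_piMr ?(ltW e0)// ler_pdivrMr ?ltr_wpDl// mul1r lerDl.
Qed.

(** * The zero function as a solution *)

Lemma Lfun2_cst0 : (fun=> 0) \in Lfun mu 2%:E.
Proof.
apply: Lfun2_sqr => //.
have := integrable0 mu [set: R].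
by apply: eq_integrable => // x _ /=; rewrite expr0n.
Qed.

Lemma is_fourier0 : is_fourier (fun=> 0) (fun=> 0) (fun=> 0 : R).
Proof.
have L0 := Lfun2_cst0.
have z c n xi : \int[mu]_(x in `[- n%:R, n%:R]) (c (x * xi) * 0) = 0 :> R.
  rewrite (_ : (fun x => _) = fun=> 0); last by apply/funext => x; rewrite mulr0.
  by rewrite /Rintegral integral0.
have N0 (f : R -> R) : f =1 (fun=> 0) -> Lnorm mu 2%:E (EFin \o (f \- (fun=> 0))%R) = 0%E.
  move=> f0; rewrite (_ : EFin \o _ = cst 0%E) ?Lnorm0//.
  by apply/funext => x /=; rewrite f0 subr0.
split=> //.
  rewrite (_ : (fun n => _) = cst 0%E); first exact: cvg_cst.
  by apply/funext => n; apply: N0 => xi; rewrite /fourier_trunc_re z mulr0.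
rewrite (_ : (fun n => _) = cst 0%E); first exact: cvg_cst.
by apply/funext => n; apply: N0 => xi; rewrite /fourier_trunc_im z mulr0.
Qed.

Lemma sobolev_norm0 s : sobolev_norm s (fun=> 0 : R) = 0%E.
Proof.
apply/eqP; rewrite eq_le; apply/andP; split.
  apply: ereal_inf_lbound; exists (fun=> 0), (fun=> 0); split; first exact: is_fourier0.
  rewrite (_ : EFin \o _ = cst 0%E) ?Lnorm0//.
  by apply/funext => x /=; rewrite expr0n /= addr0 sqrtr0 mulr0.
by apply: le_ereal_inf_tmp => _ [a [b [_ ->]]]; exact: Lnorm_ge0.
Qed.

Lemma sobolev0 s : sobolev s (fun=> 0 : R).
Proof. by split; [exact: Lfun2_cst0|rewrite sobolev_norm0]. Qed.

Lemma C0_sobolev0 s J : C0_sobolev s J (fun _ _ => 0 : R).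
Proof.
split=> [t _|t0 _]; first by split; [exact: cst_continuous|exact: sobolev0].
rewrite (_ : (fun t => _) = cst 0%E); first exact: cvg_cst.
apply/funext => t; rewrite -[RHS](sobolev_norm0 s); congr sobolev_norm.
by apply/funext => x /=; rewrite subr0.
Qed.

(** With [J] the half-line, this is the global extension in the theorem. *)
Lemma solution0 s J : solution s J (fun _ _ => 0 : R).
Proof.
split; first exact: C0_sobolev0.
exists (fun _ _ => 0); split; first exact: C0_sobolev0.
  move=> t0 _; rewrite (_ : (fun t => _) = cst 0%E); first exact: cvg_cst.
  apply/funext => t; rewrite -[RHS](sobolev_norm0 (s - 1)); congr sobolev_norm.
  by apply/funext => x /=; rewrite !subr0 mul0r.
move=> t x _; rewrite mul0r !add0r.
rewrite (_ : Lambda_m2 _ = cst 0) ?derive1_cst//.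
apply/funext => y; rewrite /Lambda_m2 (_ : (fun z => _) = fun=> 0).
  by rewrite /Rintegral integral0.
by apply/funext => z; rewrite derive1_cst expr0n /= !mulr0.
Qed.

Lemma derive1_eq0_on_open f (I : set R) x : open I -> (forall y, I y -> f y = 0) -> I x ->
  derive1 f x = 0.
Proof.
move=> oI fI Ix; rewrite -(@derive1_cst R R 0 x) !derive1E.
apply: near_eq_derive => //.
have : nbhs x I by exact: open_nbhs_nbhs.
by apply: filterS => y /fI.
Qed.

(** The difference quotient vanishes at [x], so its distance to [ut t0] there is [|ut t0 x|]. The
    sup bound of order [s - 1 > 1/2] makes it arbitrarily small. *)
Lemma time_derivative_eq0 s (T t0 : R) u ut x : 3 / 2 < s -> 0 < t0 < T ->
  (forall t, `[0, T[%classic t -> continuous (u t)) ->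
  (forall t, `[0, T[%classic t -> continuous (ut t)) ->
  sobolev_time_derivative (s - 1) `[0, T[ u ut ->
  (forall t, 0 < t < T -> u t x = 0) -> ut t0 x = 0.
Proof.
move=> s2 /andP[t00 t0T] cu cut du ux.
have s12 : 1 / 2 < s - 1 by lra.
have [K K0 HK] := sobolev_sup_bound s12.
have Jt0 : `[0, T[%classic t0 by rewrite /= in_itv /= (ltW t00).
have small e : 0 < e -> `|ut t0 x| <= K * e.
  move=> e0.
  have near1 : \forall t \near t0^', `[0, T[%classic t ->
      (sobolev_norm (s - 1) (fun y => (u t y - u t0 y) / (t - t0) - ut t0 y)%R < e%:E)%E.
    exact: (@cvge0_lt _ _ _ _ _ (du t0 Jt0) e0).
  have near2 : \forall t \near t0^', 0 < t < T.
    have : \forall t \near t0, 0 < t < T.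
      by near=> t; apply/andP; split; near: t; [exact: lt_nbhsr|exact: lt_nbhsl].
    exact: cvg_within.
  have [t [h1 h2]] := filter_ex (filterI near1 near2).
  have Jt : `[0, T[%classic t by rewrite /= in_itv /=; case/andP: h2 => /ltW -> ->.
  have cg : continuous (fun y => (u t y - u t0 y) / (t - t0) - ut t0 y).
    move=> y; apply: cvgB; last exact: cut.
    by apply: cvgMr_tmp; apply: cvgB; exact: cu.
  have := HK _ _ x cg (h1 Jt).
  by rewrite (ux t h2) (ux t0) ?t00// subrr mul0r sub0r normrN.
exact: norm_le_scaled_eq0 K0 small.
Unshelve. all: by end_near. Qed.

End vanishing.

Theorem theorem2p2 (R : realType) (T s : R) (I : set R) (u : R -> R -> R)
  (T_gt0 : 0 < T) (s_gt : 3 / 2 < s)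
  (I_neq0 : I !=set0) (I_open : open I) (I_itv : is_interval I)
  (u_sol : solution s `[0, T[ u)
  (u_Omega : forall t x, (`]0, T[ `*` I) (t, x) -> u t x = 0) :
  (forall t x, 0 <= t < T -> u t x = 0) /\
  (exists U : R -> R -> R,
     solution s `[0, +oo[ U /\
     (forall t x, 0 <= t < T -> U t x = u t x)).
Proof.
suff u0 t x : 0 <= t < T -> u t x = 0.
  split=> //; exists (fun _ _ => 0); split; first exact: solution0.
  by move=> t x tT; rewrite u0.
have [[u_reg u_cont] [ut [[ut_reg _] du eqn]]] := u_sol.
have JP r : `[0, T[%classic r <-> 0 <= r < T by rewrite /= in_itv.
have uI r y : 0 < r < T -> I y -> u r y = 0.
  by move=> rT Iy; apply: u_Omega; split => //=; rewrite in_itv.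
(* The argument works at one fixed positive time [r], where [I] is interior to the vanishing set in
   space and time. *)
have pos r y : 0 < r < T -> u r y = 0.
  move=> rT; have Jr : `[0, T[%classic r by apply/JP; case/andP: rT => /ltW -> ->.
  have [cu su] := u_reg r Jr.
  have [du1 cu1 [M u1M]] := sobolev_C1 s_gt cu su.
  have u1I z : I z -> derive1 (u r) z = 0.
    by apply: derive1_eq0_on_open => // w; exact: uI.
  pose h z := 3 / 2 * derive1 (u r) z ^+ 2.
  have h0 : forall z, h z = 0.
    apply: (@Lambda_m2_constant _ I h (3 / 2 * M ^+ 2)) => //.
    - by move=> z; rewrite mulr_ge0 ?sqr_ge0// divr_ge0.
    - move=> z; rewrite ler_wpM2l ?divr_ge0// -real_normK ?num_real//.
      by rewrite lerXn2r ?nnegrE// (le_trans _ (u1M z)).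
    - move=> z; apply: cvgMl_tmp.
      apply: (@continuous_comp _ _ _ (derive1 (u r)) (fun w : R => w ^+ 2)); first exact: cu1.
      exact: exprn_continuous.
    - by move=> z Iz; rewrite /h u1I// expr0n /= mulr0.
    (* On [I] both [u] and [ut] vanish, so the equation retains only the non-local term. *)
    - move=> z Iz; have := eqn r z Jr.
      rewrite (uI r z rT Iz) mul0r addr0 (time_derivative_eq0 s_gt rT _ _ du) ?add0r//.
      + by move=> w /u_reg[].
      + by move=> w /ut_reg[].
      + by move=> w wT; exact: uI.
  (* From [h = 0] the space derivative vanishes on the whole line; [u r] is constant, with value 0
     at a point of [I]. *)
  have u10 (z : R) : is_derive z 1 (u r) 0.
    split; first exact: du1.
    rewrite -derive1E; apply/eqP.
    have /eqP := h0 z; rewrite /h mulf_eq0 sqrf_eq0.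
    by case/orP => //; rewrite mulf_eq0 invr_eq0 !pnatr_eq0.
  have [z Iz] := I_neq0.
  by rewrite (is_derive_0_is_cst y z u10) uI.
(* Time 0 is outside [Omega]. There [u 0] is the limit in [H^s] of the zero functions [u r] as [r]
   decreases to 0, and the sup bound gives [u 0 x = 0]. *)
move=> /andP[]; rewrite le_eqVlt => /orP[/eqP <- _|t0 tT]; last by rewrite pos// t0.
have s12 : 1 / 2 < s by lra.
have [K K0 HK] := sobolev_sup_bound s12.
have J0 : `[0, T[%classic 0 by apply/JP; rewrite lexx.
have small e : 0 < e -> `|u 0 x| <= K * e.
  move=> e0.
  have near1 : \forall r \near (0 : R), `[0, T[%classic r ->
      (sobolev_norm s (u r \- u 0)%R < e%:E)%E.
    exact: (@cvge0_lt _ _ _ _ _ _ (u_cont 0 J0) e0).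
  have near2 : \forall r \near 0^'+, `[0, T[%classic r ->
      (sobolev_norm s (u r \- u 0)%R < e%:E)%E by exact: cvg_within near1.
  have near3 : \forall r \near 0^'+, 0 < r < T.
    by near=> r; apply/andP; split; near: r; [exact: nbhs_right_gt|exact: nbhs_right_lt].
  have [r [h1 h2]] := filter_ex (filterI near2 near3).
  have Jr : `[0, T[%classic r by apply/JP; case/andP: h2 => /ltW -> ->.
  have cg : continuous (u r \- u 0).
    by move=> y; apply: cvgB; [exact: (u_reg r Jr).1|exact: (u_reg 0 J0).1].
  by have := HK _ _ x cg (h1 Jr); rewrite /= pos// sub0r normrN.
exact: norm_le_scaled_eq0 K0 small.
Unshelve. all: by end_near. Qed.
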